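(* Let $\{X_j\}_{j\ge 1}$ be a sequence of independent (but not necessarily identically distributed) real random variables with $E[X_j]=0$ and $\operatorname{Var}[X_j]=\sigma_j^2<\infty$, let $\{a_j\}_{j\ge1}$ be a real sequence, and for $0<p<1$ let $\nu_p$ be a geometric random variable with mean $1/p$, independent of the $X_j$'s. Suppose that (1) $\lim_{n\to\infty} n^{-\alpha}\sigma_n^2=0$ for some $0<\alpha<1$, and the limit $\sigma^2:=\lim_{n\to\infty}\frac1n\sum_{j=1}^n\sigma_j^2$ exists (finite) and satisfies $\sigma^2>0$; (2) the limit $a:=\lim_{n\to\infty}\frac1n\sum_{j=1}^n a_j$ exists (finite); and (3) for all $\epsilon>0$, $$\lim_{p\to0}\sum_{j=1}^\infty(1-p)^{j-1}p\,E\left[X_j^2\,\mathbf 1\{|X_j|\ge\epsilon p^{-1/2}\}\right]=0.$$ Then, as $p\to0$, the geometric sum $p^{1/2}\sum_{j=1}^{\nu_p}(X_j+p^{1/2}a_j)$ converges in distribution to $\mathcal{AL}(0,a,\sigma)$, where $\sigma=\sqrt{\sigma^2}>0$.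
   Context: A geometric random variable $\nu_p$ with mean $1/p$ satisfies $P(\nu_p=n)=(1-p)^{n-1}p$ for $n=1,2,\dots$. For $m,a\in\mathbb R$ and $\sigma>0$, $\mathcal{AL}(m,a,\sigma)$ denotes the (asymmetric) Laplace distribution on $\mathbb R$, i.e. the distribution with characteristic function $\phi(t)=\dfrac{e^{imt}}{1-iat+\sigma^2t^2/2}$. $\mathbf 1\{A\}$ is the indicator of the event $A$. *)

(* Defs.v *)
From HB Require Import structures.
From mathcomp Require Import all_boot all_order all_algebra finmap.
From mathcomp Require Import complex.
From mathcomp Require Import all_classical all_reals all_analysis measurable_realfun.

Set Implicit Arguments.
Unset Strict Implicit.
Unset Printing Implicit Defensive.

Import Order.TTheory GRing.Theory Num.Theory.
Import numFieldNormedType.Exports.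

Local Open Scope classical_set_scope.
Local Open Scope ring_scope.

Section independence.
Context {d : measure_display} {T : measurableType d} {R : realType}.
Variable P : probability T R.

Definition mutually_independent d' (T' : measurableType d') (I : choiceType)
    (X : I -> {RV P >-> T'}) : Prop :=
  forall (J : {fset I}) (A : I -> set T'),
    (forall i, i \in J -> measurable (A i)) ->
    P (\bigcap_(i in [set` J]) (X i @^-1` A i)) =
    (\prod_(i <- J) P (X i @^-1` A i))%E.

Definition generated_sigma_algebra d' (T' : measurableType d') (I : Type)
    (X : I -> {RV P >-> T'}) : set_system T :=
  <<s \bigcup_i preimage_set_system setT (X i) measurable >>.

(* [N] is independent of the whole family [X], i.e. of the sigma-algebra that
   the [X i] generate jointly, not merely of each [X i] separately *)
Definition independent_of_family d1 (T1 : measurableType d1)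
    d2 (T2 : measurableType d2) (I : Type)
    (N : {RV P >-> T1}) (X : I -> {RV P >-> T2}) : Prop :=
  forall (B : set T1) (A : set T),
    measurable B -> generated_sigma_algebra X A ->
    P (N @^-1` B `&` A) = (P (N @^-1` B) * P A)%E.

(* number of trials, hence supported on 1, 2, ... *)
Definition geometric_rv (p : R) (N : {RV P >-> nat}) : Prop :=
  forall n : nat, P (N @^-1` [set n.+1]) = ((1 - p) ^+ n * p)%:E.

End independence.
Arguments mutually_independent {d T R} P {d' T' I} X.
Arguments generated_sigma_algebra {d T R} P {d' T' I} X.
Arguments independent_of_family {d T R} P {d1 T1 d2 T2 I} N X.
Arguments geometric_rv {d T R} P p N.

Section geometric_sum.
Context {d : measure_display} {T : measurableType d} {R : realType}.
Variable P : probability T R.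
Variables (X : nat -> {RV P >-> R}) (a : nat -> R).

(* [X j] and [a j] are the (j+1)-st terms of their sequences *)
Definition geometric_sum (p : R) (N : {RV P >-> nat}) (w : T) : R :=
  Num.sqrt p * \sum_(j < N w) (X j w + Num.sqrt p * a j).

Lemma measurable_geometric_sum (p : R) (N : {RV P >-> nat}) :
  measurable_fun [set: T] (geometric_sum p N).
Proof.
move=> _ B mB; rewrite setTI.
pose S n w : R := Num.sqrt p * \sum_(j < n) (X j w + Num.sqrt p * a j).
have -> : geometric_sum p N @^-1` B =
    \bigcup_n (N @^-1` [set n] `&` S n @^-1` B).
  apply/seteqP; split=> [w Bw|w [n _ [/= <-]]] //.
  by exists (N w).
apply: bigcupT_measurable => n; apply: measurableI.
  by rewrite -[X in measurable X]setTI; exact: measurable_funP.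
rewrite -[X in measurable X]setTI.
have : measurable_fun [set: T] (S n).
  apply: measurable_funM => //; apply: measurable_sum => j.
  exact: measurable_funD.
exact.
Qed.

HB.instance Definition _ (p : R) (N : {RV P >-> nat}) :=
  isMeasurableFun.Build _ _ _ _ (geometric_sum p N)
    (measurable_geometric_sum p N).

End geometric_sum.
Arguments geometric_sum {d T R} P X a p N w.

Section convergence.
Context {d : measure_display} {T : measurableType d} {R : realType}.
Variable P : probability T R.

Definition cvg_in_distribution (I : Type) (F : set_system I)
    (Y : I -> {RV P >-> R}) (mu : probability (measurableTypeR R) R) : Prop :=
  forall x : R, {for x, continuous (fun y : R => mu `]-oo, y]%classic)} ->
    cdf (Y i) x @[i --> F] --> mu `]-oo, x]%classic.

End convergence.
Arguments cvg_in_distribution {d T R} P {I} F Y mu.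

Section asymmetric_laplace.
Context {R : realType}.
Local Open Scope complex_scope.

Definition characteristic_function (mu : probability (measurableTypeR R) R)
    (t : R) : R[i] :=
  (\int[mu]_x cos (t * x))%R +i* (\int[mu]_x sin (t * x))%R.

(* [cos (m * t) +i* sin (m * t)] is exp(imt), and the denominator is
   1 - iat + sigma^2 t^2 / 2 *)
Definition is_asymmetric_laplace (m a sigma : R)
    (mu : probability (measurableTypeR R) R) : Prop :=
  forall t : R, characteristic_function mu t =
    (cos (m * t) +i* sin (m * t)) /
    ((1 + sigma ^+ 2 * t ^+ 2 / 2) +i* (- (a * t))).

End asymmetric_laplace.

(* Main.v *)
Require Import Defs.
From HB Require Import structures.
From mathcomp Require Import all_boot all_order all_algebra finmap.
From mathcomp Require Import complex.
From mathcomp Require Import all_classical all_reals all_analysis measurable_realfun.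
From mathcomp Require Import ring lra.

Set Implicit Arguments.
Unset Strict Implicit.
Unset Printing Implicit Defensive.

Import Order.TTheory GRing.Theory Num.Theory.
Import numFieldNormedType.Exports.

Local Open Scope classical_set_scope.
Local Open Scope ring_scope.

(* Write T_n for the sum of the first n terms with every a_j replaced by a, and
   let mu be the law of the difference of two independent exponential variables
   with means m1, m2 such that m1 - m2 = a and m1 m2 = sigma2 / 2.  Two
   integrations by parts show that u(x) = integral of f(x + y) mu(dy), for f
   smooth with bounded derivatives, solves the resolvent equation
     u - a u' - sigma2 / 2 u'' = f,   u(0) = integral of f d mu;
   taking f trigonometric gives the characteristic function of mu.
   Telescoping (1-p)^n E u(T_n) and a Taylor expansion of u at each step turn
   the sum of (1-p)^n p E f(T_{n+1}) into u(0), up to an error made of the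
   Lindeberg terms and of the fluctuations s_n^2 - sigma2; summation by parts
   kills the latter, since their partial sums are o(n) and E u''(T_n) varies
   slowly.  So no central limit theorem and no continuity theorem for
   characteristic functions is needed: convergence of distribution functions
   follows by squeezing half-line indicators between logistic steps f. *)

(** Drift and variance are averaged differently. Replacing every [a_j] by [a] moves the n-th sum by
    a deterministic amount, [p] times the sum of the [a_j - a], which is [p] times [o(n)]; as [n p]
    is of order one under the geometric weights, a Lipschitz bound on [f] is enough. The variances
    belong to random terms: [s_n^2 - sigma2] appears only as the coefficient of [E u''(T_n)] in the
    expansion, and is small only on average, hence the summation by parts. That needs [E u''(T_n)]
    to move by [O(p (1 + s_n^2))] per step, which holds because [X_n] is centred and independent of
    [T_n], so that the term of order [sqrt p] disappears. Every series over n is cut at some N, at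
    the price of boundary terms [(1 - p)^N (b N + c)]. These vanish as N grows with p fixed, so N is
    always chosen after p. *)

Section BoundedIntegrals.
Context {d : measure_display} {T : measurableType d} {R : realType}.
Variable P : probability T R.

Lemma bounded_integrable (f : T -> R) (M : R) :
  measurable_fun setT f -> (forall x, `|f x| <= M) ->
  P.-integrable setT (EFin \o f).
Proof.
move=> mf fM; apply: measurable_bounded_integrable => //.
  exact: le_lt_trans (probability_le1 P measurableT) (ltry 1).
by exists M; split; rewrite ?num_real// => N MN x _; exact: le_trans (fM x) (ltW MN).
Qed.

Lemma Rintegral_probability_cst (r : R) : \int[P]_x r = r.
Proof.
rewrite Rintegral_cst// -[RHS]mulr1; congr (_ * _).
exact: (congr1 fine (probability_setT P)).
Qed.

Lemma normr_Rintegral_le (f : T -> R) (M : R) :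
  measurable_fun setT f -> (forall x, `|f x| <= M) ->
  `|\int[P]_x f x| <= M.
Proof.
move=> mf fM.
apply: (le_trans (le_normr_Rintegral _ (bounded_integrable mf fM))) => //.
rewrite -[leRHS]Rintegral_probability_cst.
apply: le_Rintegral => //.
- apply: (@bounded_integrable _ M); first exact: measurableT_comp.
  by move=> x; rewrite normr_id.
- exact: (@bounded_integrable (cst M) `|M|).
Qed.

End BoundedIntegrals.

(** * Exponential law and its first-order operator *)

Section Exponential.
Context {R : realType}.
Variable rate : R.
Hypothesis rate_gt0 : 0 < rate.
Local Notation leb := (@lebesgue_measure R).

Definition exponential_law : probability (measurableTypeR R) R :=
  exponential_distribution_exponential_prob__canonical__probability_measure_Probability
    rate_gt0.

Lemma exponential_law_dominated : exponential_law `<< leb.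
Proof.
apply/null_content_dominatesP => A mA A0.
rewrite /= /exponential_prob; apply: null_set_integral => //.
have mp : measurable_fun setT (EFin \o exponential_pdf rate).
  by apply/measurable_EFinP; exact: measurable_exponential_pdf.
exact: (@measurable_funTS _ _ _ _ A _ mp).
Qed.

Lemma integral_exponential_law (f : R -> \bar R) :
  (exponential_law).-integrable setT f ->
  (\int[exponential_law]_x f x =
   \int[leb]_x (f x * (exponential_pdf rate x)%:E))%E.
Proof.
move=> intf; have mf := measurable_int _ intf.
rewrite -(Radon_Nikodym_change_of_variables exponential_law_dominated)//=.
apply: ae_eq_integral => //.
- apply: emeasurable_funM => //; apply: (measurable_int leb).
  by apply: Radon_Nikodym_integrable; exact: exponential_law_dominated.
- apply: emeasurable_funM => //=; apply/measurableT_comp => //=.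
  exact: measurable_exponential_pdf.
- apply: ae_eqe_mul2l => /=.
  rewrite Radon_NikodymE//=; first exact: exponential_law_dominated.
  move=> Qmu; case: cid => /= h [h1 h2 h3].
  apply: integral_ae_eq => //=.
  + by apply/measurableT_comp => //; exact: measurable_exponential_pdf.
  + by move=> E _ mE; rewrite -h3.
Qed.

(** Integration by parts against the exponential density: the law inverts [1 - D / rate], evaluated
    at 0. *)
Lemma Rintegral_exponential_law_sub_derive (v v' : R -> R) (M : R) :
  (forall x : R, is_derive x 1 v (v' x)) -> continuous v' ->
  (forall x, `|v x| <= M) -> (forall x, `|v' x| <= M) ->
  \int[exponential_law]_x (v x - v' x / rate) = v 0.
Proof.
move=> dv cv' vM v'M.
have cv : continuous v.
  by move=> x; apply/differentiable_continuous/derivable1_diffP.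
(* [N] bounds [g]; adding it makes the integrand nonnegative, as the improper fundamental theorem of
   calculus below requires. It is subtracted again at the end. *)
pose N := M + M / rate.
pose g x := v x - v' x / rate.
have cg : continuous g.
  move=> x; apply: cvgB; first exact: cv.
  by apply: cvgMr_tmp; exact: cv'.
have mg : measurable_fun setT g by exact: continuous_measurable_fun.
have gN x : `|g x| <= N.
  rewrite (le_trans (ler_normB _ _))// lerD// normrM (gtr0_norm (x := rate^-1)) ?invr_gt0//.
  by rewrite ler_pM2r// invr_gt0.
(* Antiderivative of the density times [g + N]; it vanishes at infinity, and [- F 0 = v 0 + N]. *)
pose F x := - (expR (- rate * x) * (v x + N)).
have cF : continuous F.
  move=> x; apply: cvgN; apply: cvgM; last by apply: cvgD; [exact: cv|exact: cvg_cst].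
  apply: continuous_comp; last exact: continuous_expR.
  by apply: cvgMl_tmp; exact: cvg_id.
have dF (x : R) : is_derive x 1 F (rate * expR (- rate * x) * (g x + N)).
  have dl : is_derive x 1 (fun y : R => - rate * y) (- rate).
    by apply: is_derive_eq; rewrite scaler1.
  have de : is_derive x 1 (fun y : R => expR (- rate * y)) (- rate * expR (- rate * x)).
    rewrite mulrC; apply: (@is_derive1_comp _ expR (fun y : R => - rate * y)).
  have := dv x => dvx.
  rewrite /F; apply: is_derive_eq.
  rewrite /g /GRing.scale /= addr0; field.
  by rewrite gt_eqF.
have expNy : expR (- rate * x) @[x --> +oo] --> (0 : R).
  rewrite (_ : (fun x => expR (- rate * x)) =
               (fun z => expR (- z)) \o (fun z => rate * z)); last first.
    by apply: eq_fun => x; rewrite mulNr.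
  apply: (@cvg_comp _ _ _ _ _ _ (pinfty_nbhs R)); last exact: cvgr_expR.
  exact: gt0_cvgMry.
have gN_ge0 x : 0 <= g x + N.
  by have := gN x; rewrite ler_norml => /andP[]; lra.
have FTC : (\int[leb]_(x in `[0%R, +oo[) (rate * expR (- rate * x) * (g x + N))%:E =
  0%:E - (F 0)%:E)%E.
  apply: ge0_continuous_FTC2y.
  - by move=> x _; rewrite !mulr_ge0 ?expR_ge0 ?(ltW rate_gt0).
  - apply: continuous_subspaceT => x; apply: cvgM.
      apply: cvgMl_tmp; apply: continuous_comp; last exact: continuous_expR.
      by apply: cvgMl_tmp; exact: cvg_id.
    by apply: cvgD; [exact: cg|exact: cvg_cst].
  - apply: (@squeeze_cvgr _ _ _ _ (fun x => - (expR (- rate * x) * (M + N)))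
      (fun x => expR (- rate * x) * (M + N))).
    + near=> x; rewrite /F.
      have := vM x; rewrite ler_norml => /andP[v1 v2].
      have N0 : 0 <= N by exact: le_trans (gN 0).
      have e0 := expR_ge0 (- rate * x).
      by apply/andP; split; nra.
    + by rewrite -oppr0; apply: cvgN; rewrite -(mul0r (M + N)); apply: cvgMr_tmp.
    + by rewrite -(mul0r (M + N)); apply: cvgMr_tmp.
  - by move=> x _; exact: ex_derive.
  - by apply: cvg_at_right_filter; exact: cF.
  - by move=> x _; rewrite derive1E derive_val.
have key : \int[exponential_law]_x (g x + N) = v 0 + N.
  rewrite /Rintegral integral_exponential_law; last first.
    apply: (@bounded_integrable _ _ _ _ _ (N + N)).
      by apply: measurable_funD.
    by move=> x; rewrite ger0_norm// lerD2r; exact: le_trans (ler_norm _) (gN x).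
  transitivity (fine (\int[leb]_(x in `[0%R, +oo[) (rate * expR (- rate * x) * (g x + N))%:E)%E).
    congr fine; rewrite [RHS]integral_mkcond; apply: eq_integral => x _.
    rewrite /exponential_pdf !patchE; case: ifP => _; last by rewrite mule0.
    by rewrite -EFinM mulrC.
  by rewrite FTC /F /= mulr0 expR0 mul1r opprK add0r.
suff : \int[exponential_law]_x g x + N = v 0 + N by move/addIr.
rewrite -{1}(Rintegral_probability_cst exponential_law N) -RintegralD//.
  exact: (bounded_integrable exponential_law mg gN).
exact: (@bounded_integrable _ _ _ exponential_law (cst N) `|N|).
Unshelve. all: by end_near. Qed.
End Exponential.

Section Fubini.
Context {d1 d2 : measure_display} {T1 : measurableType d1}
  {T2 : measurableType d2} {R : realType}.
Variables (P1 : probability T1 R) (P2 : probability T2 R).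

Lemma Rintegral_prod_bounded (f : T1 * T2 -> R) (M : R) :
  measurable_fun setT f -> (forall z, `|f z| <= M) ->
  \int[(P1 \x P2)%E]_z f z = \int[P1]_x \int[P2]_y f (x, y).
Proof.
move=> mf fM.
have intf : (P1 \x P2)%E.-integrable setT (EFin \o f).
  exact: (bounded_integrable (P1 \x P2)%E mf fM).
rewrite {1}/Rintegral -integral12_prod_meas1//; congr fine.
apply: eq_integral => x _; rewrite /fubini_F /Rintegral fineK//.
apply: integrable_fin_num => //.
apply: (bounded_integrable P2 (M := M)) => //.
exact: (measurableT_comp mf (measurable_pair1 x)).
Qed.

End Fubini.

(** * Difference of two independent exponential variables *)

Section Laplace.
Context {R : realType}.
Variables rate1 rate2 : R.
Hypotheses (rate1_gt0 : 0 < rate1) (rate2_gt0 : 0 < rate2).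
Let E1 := exponential_law rate1_gt0.
Let E2 := exponential_law rate2_gt0.

Let subr_pair (z : measurableTypeR R * measurableTypeR R) : measurableTypeR R :=
  z.1 - z.2 :> R.

Let measurable_subr_pair : measurable_fun setT subr_pair.
Proof. by apply: measurable_funB; [exact: measurable_fst|exact: measurable_snd]. Qed.

HB.instance Definition _ :=
  isMeasurableFun.Build _ _ _ _ subr_pair measurable_subr_pair.

Definition exponential_difference_law : probability (measurableTypeR R) R :=
  distribution (E1 \x E2)%E subr_pair.

(* [1 - a D - D^2 / (rate1 * rate2)] factors as
   [(1 - D / rate1) * (1 + D / rate2)], one factor per exponential variable. *)
Lemma Rintegral_exponential_difference_law (u u1 u2 : R -> R) (M : R) :
  (forall x : R, is_derive x 1 u (u1 x)) ->
  (forall x : R, is_derive x 1 u1 (u2 x)) -> continuous u2 ->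
  (forall x, `|u x| <= M) -> (forall x, `|u1 x| <= M) ->
  (forall x, `|u2 x| <= M) ->
  \int[exponential_difference_law]_x
    (u x - (rate1^-1 - rate2^-1) * u1 x - u2 x / (rate1 * rate2)) = u 0.
Proof.
move=> du du1 cu2 uM u1M u2M.
pose g x := u x - (rate1^-1 - rate2^-1) * u1 x - u2 x / (rate1 * rate2).
have cu : continuous u.
  by move=> x; apply/differentiable_continuous/derivable1_diffP.
have cu1 : continuous u1.
  by move=> x; apply/differentiable_continuous/derivable1_diffP.
have mg : measurable_fun setT g.
  apply: continuous_measurable_fun => x; apply: cvgB; last by apply: cvgMr_tmp; exact: cu2.
  by apply: cvgB; [exact: cu|apply: cvgMl_tmp; exact: cu1].
pose N := M + `|rate1^-1 - rate2^-1| * M + M * `|(rate1 * rate2)^-1|.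
have gN x : `|g x| <= N.
  rewrite (le_trans (ler_normB _ _))// lerD// ?(le_trans (ler_normB _ _))//.
    by rewrite lerD// normrM ler_wpM2l.
  by rewrite normrM ler_wpM2r.
have mgs : measurable_fun setT (g \o subr_pair) by exact: measurableT_comp.
transitivity (\int[(E1 \x E2)%E]_z (g (subr_pair z))).
  rewrite /Rintegral integral_distribution//.
    exact/measurable_EFinP.
  exact: (bounded_integrable (E1 \x E2)%E mgs (fun z => gN (subr_pair z))).
rewrite (Rintegral_prod_bounded _ _ mgs (fun z => gN (subr_pair z))) {1}/subr_pair /=.
(* The factor [1 - D / rate1] applied to [u]; then [g] is [1 + D / rate2] applied to [w]. *)
pose w x := u x - u1 x / rate1.
pose w' x := u1 x - u2 x / rate1.
have dw (x : R) : is_derive x 1 w (w' x).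
  have := du x; have := du1 x => dux du1x.
  by rewrite /w; apply: is_derive_eq; rewrite /w' /GRing.scale /=; ring.
have wM x : `|w x| <= M + M / rate1.
  rewrite (le_trans (ler_normB _ _))// lerD// normrM (gtr0_norm (x := rate1^-1)) ?invr_gt0//.
  by rewrite ler_pM2r ?invr_gt0.
have w'M x : `|w' x| <= M + M / rate1.
  rewrite (le_trans (ler_normB _ _))// lerD// normrM (gtr0_norm (x := rate1^-1)) ?invr_gt0//.
  by rewrite ler_pM2r ?invr_gt0.
have cw' : continuous w'.
  by move=> x; apply: cvgB; [exact: cu1|apply: cvgMr_tmp; exact: cu2].
transitivity (\int[E1]_x w x); last first.
  exact: (Rintegral_exponential_law_sub_derive rate1_gt0 du cu1 uM u1M).
(* The second variable is subtracted, so as a function of [y] the integrand is [1 - D / rate2]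
   applied to [w (x - y)]: the inner integral is its value at [y = 0], namely [w x]. *)
apply: eq_Rintegral => x _.
have dW (y : R) : is_derive y 1 (fun y => w (x - y)) (- w' (x - y)).
  have dl : is_derive y 1 (fun z : R => x - z) (- 1).
    by apply: is_derive_eq; rewrite add0r mul1r.
  rewrite (_ : - w' (x - y) = w' (x - y) * - 1); last by rewrite mulrN1.
  exact: (@is_derive1_comp _ w (fun z : R => x - z)).
have cW : continuous (fun y => - w' (x - y)).
  move=> y; apply: cvgN; apply: (@continuous_comp _ _ _ (fun y : R => x - y) w').
    by apply: cvgB; [exact: cvg_cst|exact: cvg_id].
  exact: cw'.
have := Rintegral_exponential_law_sub_derive rate2_gt0 dW cW
  (fun y => wM (x - y)).
rewrite subr0 => <-; last by move=> y; rewrite normrN.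
apply: eq_Rintegral => y _; rewrite /= /g /w /w'; field.
by rewrite !gt_eqF.
Qed.

End Laplace.

(** * The limit law as inverse of a second-order operator *)

Section Resolvent.
Context {R : realType}.

(* [mu] is the law whose convolution operator inverts
   [1 - a D - s2 / 2 D^2]. *)
Definition resolvent_law (a s2 : R) (mu : probability (measurableTypeR R) R) :=
  forall (u u1 u2 : R -> R) (M : R),
  (forall x : R, is_derive x 1 u (u1 x)) ->
  (forall x : R, is_derive x 1 u1 (u2 x)) -> continuous u2 ->
  (forall x, `|u x| <= M) -> (forall x, `|u1 x| <= M) ->
  (forall x, `|u2 x| <= M) ->
  \int[mu]_x (u x - a * u1 x - s2 / 2 * u2 x) = u 0.

Lemma resolvent_law_exists (a s2 : R) : 0 < s2 ->
  exists mu, resolvent_law a s2 mu.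
Proof.
move=> s2_gt0.
(* [b] is the sum of the two means, since [(m1 + m2)^2 = (m1 - m2)^2 + 4 m1 m2]. As [s2 > 0], it
   exceeds [|a|], which makes both means positive. *)
pose b := Num.sqrt (a ^+ 2 + 2 * s2).
have b2 : b ^+ 2 = a ^+ 2 + 2 * s2.
  by rewrite sqr_sqrtr// addr_ge0 ?sqr_ge0// mulr_ge0// ltW.
have b0 : 0 <= b by exact: sqrtr_ge0.
have t1 : 0 < (b + a) / 2 by apply: divr_gt0 => //; nra.
have t2 : 0 < (b - a) / 2 by apply: divr_gt0 => //; nra.
have r1 : 0 < ((b + a) / 2)^-1 by rewrite invr_gt0.
have r2 : 0 < ((b - a) / 2)^-1 by rewrite invr_gt0.
exists (exponential_difference_law r1 r2) => u u1 u2 M du du1 cu2 uM u1M u2M.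
rewrite -[RHS](Rintegral_exponential_difference_law r1 r2 du du1 cu2 uM u1M u2M).
apply: eq_Rintegral => x _; rewrite !invrK -invfM invrK.
have -> : (b + a) / 2 - (b - a) / 2 = a by lra.
rewrite (_ : (b + a) / 2 * ((b - a) / 2) = s2 / 2); last first.
  by transitivity ((b ^+ 2 - a ^+ 2) / 4); [field|rewrite b2; lra].
by rewrite (mulrC (u2 x)).
Qed.

Lemma resolvent_law_asymmetric_laplace (a s2 : R) mu : 0 < s2 ->
  resolvent_law a s2 mu -> is_asymmetric_laplace 0 a (Num.sqrt s2) mu.
Proof.
move=> s2_gt0 mu_res t.
have dl (x : R) : is_derive x 1 (fun y : R => t * y) t.
  by apply: is_derive_eq; rewrite scaler1.
have dcos (x : R) : is_derive x 1 (fun y : R => cos (t * y)) (- t * sin (t * x)).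
  rewrite mulNr mulrC -mulNr.
  exact: (@is_derive1_comp _ cos (fun y : R => t * y)).
have dsin (x : R) : is_derive x 1 (fun y : R => sin (t * y)) (t * cos (t * x)).
  rewrite mulrC.
  exact: (@is_derive1_comp _ sin (fun y : R => t * y)).
have d2cos (x : R) :
    is_derive x 1 (fun y : R => - t * sin (t * y)) (- t ^+ 2 * cos (t * x)).
  by apply: is_derive_eq; rewrite /GRing.scale /=; ring.
have d2sin (x : R) :
    is_derive x 1 (fun y : R => t * cos (t * y)) (- t ^+ 2 * sin (t * x)).
  by apply: is_derive_eq; rewrite /GRing.scale /=; ring.
have ccos : continuous (fun y : R => cos (t * y)).
  by move=> x; apply/differentiable_continuous/derivable1_diffP.
have csin : continuous (fun y : R => sin (t * y)).
  by move=> x; apply/differentiable_continuous/derivable1_diffP.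
have cos_le (x : R) : `|cos x| <= 1 by rewrite ler_norml cos_geN1 cos_le1.
have sin_le (x : R) : `|sin x| <= 1 by rewrite ler_norml sin_geN1 sin_le1.
pose M := 1 + `|t| + t ^+ 2.
have t0 := normr_ge0 t.
have tt0 := sqr_ge0 t.
have M0 y : `|y| <= 1 -> `|y| <= M by rewrite /M; lra.
have M1 y : `|y| <= 1 -> `|t * y| <= M.
  by rewrite /M normrM => y1; have := normr_ge0 y; nra.
have M2 y : `|y| <= 1 -> `|- t ^+ 2 * y| <= M.
  by rewrite /M normrM normrN (ger0_norm tt0) => y1; have := normr_ge0 y; nra.
have Ec : \int[mu]_x (cos (t * x) - a * (- t * sin (t * x)) -
    s2 / 2 * (- t ^+ 2 * cos (t * x))) = 1.
  rewrite (mu_res _ _ _ M dcos d2cos) ?mulr0 ?cos0//.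
  - by move=> x; apply: cvgMl_tmp; exact: ccos.
  - by move=> x; exact: M0.
  - by move=> x; rewrite mulNr normrN; exact: M1.
  - by move=> x; exact: M2.
have Es : \int[mu]_x (sin (t * x) - a * (t * cos (t * x)) -
    s2 / 2 * (- t ^+ 2 * sin (t * x))) = 0.
  rewrite (mu_res _ _ _ M dsin d2sin) ?mulr0 ?sin0//.
  - by move=> x; apply: cvgMl_tmp; exact: csin.
  - by move=> x; exact: M0.
  - by move=> x; exact: M1.
  - by move=> x; exact: M2.
have icos k : mu.-integrable setT (EFin \o (fun x : R => k * cos (t * x))).
  apply: (bounded_integrable mu (M := `|k|)).
    by apply: continuous_measurable_fun => x; apply: cvgMl_tmp; exact: ccos.
  by move=> x; rewrite normrM ler_piMr.
have isin k : mu.-integrable setT (EFin \o (fun x : R => k * sin (t * x))).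
  apply: (bounded_integrable mu (M := `|k|)).
    by apply: continuous_measurable_fun => x; apply: cvgMl_tmp; exact: csin.
  by move=> x; rewrite normrM ler_piMr.
have icos1 : mu.-integrable setT (EFin \o (fun x : R => cos (t * x))).
  by have := icos 1; under eq_fun do rewrite mul1r.
have isin1 : mu.-integrable setT (EFin \o (fun x : R => sin (t * x))).
  by have := isin 1; under eq_fun do rewrite mul1r.
rewrite /characteristic_function mul0r cos0 sin0 sqr_sqrtr ?ltW//.
set C := \int[mu]_x cos (t * x); set S := \int[mu]_x sin (t * x).
(* [EC] and [ES] are the real and imaginary parts of [(C + i S) (1 + s2 t^2 / 2 - i a t) = 1]. *)
have EC : (1 + s2 * t ^+ 2 / 2) * C + a * t * S = 1.
  rewrite -[RHS]Ec -!RintegralZl// -RintegralD//.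
  by apply: eq_Rintegral => x _; field.
have ES : (1 + s2 * t ^+ 2 / 2) * S - a * t * C = 0.
  rewrite -[RHS]Es -!RintegralZl// -RintegralB//.
  by apply: eq_Rintegral => x _; field.
have D_gt0 : 0 < 1 + s2 * t ^+ 2 / 2.
  by rewrite ltr_wpDr// divr_ge0// mulr_ge0// ltW.
set z := (_ +i* (- (a * t)))%C.
have z0 : z != 0.
  by rewrite eq_complex /= negb_and (gt_eqF D_gt0).
apply: (mulIf z0); rewrite divfK// /z.
simpc; apply/eqP; rewrite eq_complex /=.
by apply/andP; split; apply/eqP; [rewrite -[RHS]EC; field|rewrite -[RHS]ES; field].
Qed.

End Resolvent.

(** * Uniform Taylor estimates *)

Section SmoothBounded.
Context {R : realType}.

(* [f k] plays the role of the [k]-th derivative; the Taylor estimates, unlike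
   differentiability, pass to convolutions by mere integration. *)
Definition taylor_bounds (M : R) (f : nat -> R -> R) (k : nat) :=
  forall x h : R,
    [/\ `|f k x| <= M, `|f k (x + h) - f k x| <= M * `|h|,
     `|f k (x + h) - f k x - h * f k.+1 x| <= M * h ^+ 2 &
     `|f k (x + h) - f k x - h * f k.+1 x - h ^+ 2 / 2 * f k.+2 x| <=
       M * `|h| ^+ 3].

Definition smooth_bounded (f : nat -> R -> R) :=
  forall k, exists2 M, 0 <= M & taylor_bounds M f k.

Lemma taylor_bounds_le (M N : R) (f : nat -> R -> R) (k : nat) :
  M <= N -> taylor_bounds M f k -> taylor_bounds N f k.
Proof.
move=> MN fM x h; have [f0 f1 f2 f3] := fM x h; split.
- exact: le_trans MN.
- by rewrite (le_trans f1)// ler_wpM2r.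
- by rewrite (le_trans f2)// ler_wpM2r ?sqr_ge0.
- by rewrite (le_trans f3)// ler_wpM2r ?exprn_ge0.
Qed.

Lemma smooth_bounded_uniform (f : nat -> R -> R) (n : nat) :
  smooth_bounded f ->
  exists2 M, 0 <= M & forall k, (k <= n)%N -> taylor_bounds M f k.
Proof.
move=> sf; elim: n => [|n [M M0 fM]].
  have [M M0 fM] := sf 0; exists M => // k.
  by rewrite leqn0 => /eqP ->.
have [N N0 fN] := sf n.+1; exists (M + N); first exact: addr_ge0.
move=> k; rewrite leq_eqVlt => /orP[/eqP ->|kn].
  by apply: taylor_bounds_le fN; rewrite lerDr.
by apply: taylor_bounds_le (fM k kn); rewrite lerDl.
Qed.

(** The derivative is bounded only for arguments up to [|h|]: Taylor remainders have derivatives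
    that grow like powers of the argument, and each use of this bound gains one power of [|h|]. *)
Lemma mvt_bound (g g' : R -> R) (M h : R) :
  (forall x : R, is_derive x 1 g (g' x)) ->
  (forall x, `|x| <= `|h| -> `|g' x| <= M) -> `|g h - g 0| <= M * `|h|.
Proof.
move=> dg g'M.
have cg : continuous g.
  by move=> x; apply/differentiable_continuous/derivable1_diffP.
have [h0|h0] := leP 0 h.
  have [c] := MVT_segment h0 (fun x _ => dg x) (continuous_subspaceT cg).
  rewrite in_itv /= subr0 => /andP[c0 ch] ->; rewrite normrM ler_wpM2r// g'M//.
  by rewrite !ger0_norm.
have [c] := MVT_segment (ltW h0) (fun x _ => dg x) (continuous_subspaceT cg).
rewrite in_itv /= sub0r => /andP[hc c0] E.
rewrite distrC E normrM normrN ler_wpM2r// g'M//.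
by rewrite !ler0_norm ?lerN2// ltW.
Qed.

(** The derivative in [h] of a Taylor remainder of [f k] is the remainder of [f k.+1] of one order
    less, so the mean value bound can be iterated. No factorials are kept in the constants. *)
Lemma derivatives_smooth_bounded (f : nat -> R -> R) :
  (forall k (x : R), is_derive x 1 (f k) (f k.+1 x)) ->
  (forall k, exists M, forall x, `|f k x| <= M) -> smooth_bounded f.
Proof.
move=> df fM k.
have [M0 f0] := fM k; have [M1 f1] := fM k.+1; have [M2 f2] := fM k.+2.
have [M3 f3] := fM k.+3.
have M0_ge0 : 0 <= M0 by exact: le_trans (f0 0).
have M1_ge0 : 0 <= M1 by exact: le_trans (f1 0).
have M2_ge0 : 0 <= M2 by exact: le_trans (f2 0).
have M3_ge0 : 0 <= M3 by exact: le_trans (f3 0).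
have dshift j x (y : R) : is_derive y 1 (fun h => f j (x + h)) (f j.+1 (x + y)).
  have dl : is_derive y 1 (fun h : R => x + h) 1.
    by apply: is_derive_eq; rewrite add0r mul1r.
  rewrite -[f j.+1 _]mulr1.
  exact: (@is_derive1_comp _ (f j) (fun h : R => x + h)).
have bound1 j M x h : (forall y, `|f j.+1 y| <= M) ->
    `|f j (x + h) - f j x| <= M * `|h|.
  move=> fjM; rewrite -{2}[x]addr0.
  by apply: (mvt_bound (dshift j x)).
have bound2 j M x h : 0 <= M -> (forall y, `|f j.+2 y| <= M) ->
    `|f j (x + h) - f j x - h * f j.+1 x| <= M * h ^+ 2.
  move=> M_ge0 fjM.
  pose g y := f j (x + y) - y * f j.+1 x.
  have dg (y : R) : is_derive y 1 g (f j.+1 (x + y) - f j.+1 x).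
    have := dshift j x y => dsy; rewrite /g; apply: is_derive_eq.
    by rewrite /GRing.scale /=; ring.
  have -> : f j (x + h) - f j x - h * f j.+1 x = g h - g 0.
    by rewrite /g addr0; ring.
  rewrite -(real_normK (num_real h)) expr2 mulrA; apply: (mvt_bound dg) => y yh.
  by rewrite (le_trans (bound1 _ _ _ _ fjM))// ler_wpM2l.
exists (M0 + M1 + M2 + M3); first by rewrite !addr_ge0.
move=> x h; have h0 := normr_ge0 h; split.
- by rewrite (le_trans (f0 x))//; lra.
- by rewrite (le_trans (bound1 _ _ _ _ f1))// ler_wpM2r//; lra.
- by rewrite (le_trans (bound2 _ _ _ _ M2_ge0 f2))// ler_wpM2r ?sqr_ge0//; lra.
- pose g y := f k (x + y) - y * f k.+1 x - y ^+ 2 / 2 * f k.+2 x.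
  have dg (y : R) :
      is_derive y 1 g (f k.+1 (x + y) - f k.+1 x - y * f k.+2 x).
    have := dshift k x y => dsy; rewrite /g; apply: is_derive_eq.
    by rewrite /GRing.scale /=; field.
  have -> : f k (x + h) - f k x - h * f k.+1 x - h ^+ 2 / 2 * f k.+2 x =
      g h - g 0.
    by rewrite /g addr0; ring.
  apply: (@le_trans _ _ (M3 * `|h| ^+ 2 * `|h|)); last first.
    by rewrite -mulrA -exprSr ler_wpM2r ?exprn_ge0//; lra.
  apply: (mvt_bound dg) => y yh; rewrite (le_trans (bound2 _ _ _ _ M3_ge0 f3))//.
  by rewrite ler_wpM2l// -(real_normK (num_real y)) lerXn2r ?nnegrE.
Qed.

Lemma smooth_bounded_continuous (f : nat -> R -> R) k :
  smooth_bounded f -> continuous (f k).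
Proof.
move=> /(_ k)[M M0 fM] x; apply/cvgrPdist_le => e e0.
near=> y.
have [_ + _ _] := fM x (y - x); rewrite addrCA subrr addr0 distrC.
move=> /le_trans; apply.
have : `|y - x| <= e / (M + 1).
  near: y; apply: cvgr_distC_le; first exact: cvg_id.
  by rewrite divr_gt0// ltr_wpDl.
rewrite ler_pdivlMr ?ltr_wpDl// => H; rewrite (le_trans _ H)// mulrC.
by rewrite ler_wpM2l// lerDl.
Unshelve. all: by end_near. Qed.

Lemma smooth_bounded_measurable (f : nat -> R -> R) k :
  smooth_bounded f -> measurable_fun setT (f k).
Proof.
by move=> sf; apply: continuous_measurable_fun; exact: smooth_bounded_continuous.
Qed.

Lemma smooth_bounded_convolution (f : nat -> R -> R)
    (mu : probability (measurableTypeR R) R) :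
  smooth_bounded f -> smooth_bounded (fun k x => \int[mu]_y f k (x + y)).
Proof.
move=> sf k; have [M M0 fM] := sf k; exists M => // x h.
have mfx j z : measurable_fun setT (fun y : measurableTypeR R => f j (z + y)).
  apply: (measurableT_comp (smooth_bounded_measurable j sf)).
  by apply: measurable_funD.
have ifx j z : mu.-integrable setT (EFin \o (fun y => f j (z + y))).
  have [N _ fN] := sf j.
  by apply: (bounded_integrable mu (mfx j z) (M := N)) => y; case: (fN (z + y) 0).
have ifxZ j z c : mu.-integrable setT (EFin \o (fun y => c * f j (z + y))).
  have [N _ fN] := sf j.
  apply: (bounded_integrable mu (M := `|c| * N)).
    by apply: measurable_funM.
  by move=> y; rewrite normrM ler_wpM2l//; case: (fN (z + y) 0).
have md1 : measurable_fun setT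
    (fun y : measurableTypeR R => f k (x + h + y) - f k (x + y)).
  exact: measurable_funB.
have md2 : measurable_fun setT (fun y : measurableTypeR R =>
    f k (x + h + y) - f k (x + y) - h * f k.+1 (x + y)).
  by apply: measurable_funB => //; apply: measurable_funM.
have b1 y : `|f k (x + h + y) - f k (x + y)| <= M * `|h|.
  by rewrite (addrAC x h); case: (fM (x + y) h).
have b2 y : `|f k (x + h + y) - f k (x + y) - h * f k.+1 (x + y)| <= M * h ^+ 2.
  by rewrite (addrAC x h); case: (fM (x + y) h).
have id1 := bounded_integrable mu md1 b1.
have id2 := bounded_integrable mu md2 b2.
split.
- by apply: normr_Rintegral_le => // y; case: (fM (x + y) 0).
- by rewrite -RintegralB//; apply: normr_Rintegral_le.
- by rewrite -RintegralZl// -!RintegralB//; apply: normr_Rintegral_le.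
- rewrite -!RintegralZl// -!RintegralB//; apply: normr_Rintegral_le.
    by apply: measurable_funB => //; apply: measurable_funM.
  by move=> y; rewrite (addrAC x h); case: (fM (x + y) h).
Qed.

End SmoothBounded.

(** * Smooth approximations of half-line indicators *)

Section Logistic.
Context {R : realType}.

(** Decreasing, contrary to the usual convention, because it smooths the indicator of a half-line
    unbounded below. *)
Definition logistic (x : R) : R := (1 + expR x)^-1.

Lemma logistic_gt0 x : 0 < logistic x.
Proof. by rewrite invr_gt0 addr_gt0 ?expR_gt0. Qed.

Lemma logistic_le1 x : logistic x <= 1.
Proof. by rewrite invf_le1 ?addr_gt0 ?expR_gt0// lerDl expR_ge0. Qed.

Lemma is_derive_logistic (x : R) :
  is_derive x 1 logistic (- (logistic x * (1 - logistic x))).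
Proof.
have e0 : 1 + expR x != 0 by rewrite gt_eqF// addr_gt0 ?expR_gt0.
pose D (y : R) : R := 1 + expR y.
have dD : is_derive x 1 D (expR x).
  by apply: is_derive_eq; rewrite add0r mul1r.
have cD : derivable D x 1 by exact: ex_derive.
apply: (DeriveDef (@derivableV _ _ D x 1 e0 cD)).
rewrite (@deriveV _ _ D x 1 e0 cD) (@derive_val _ _ _ _ _ _ _ dD).
rewrite /logistic /GRing.scale /= -/(D x).
have {}e0 : D x != 0 by [].
have -> : expR x = D x - 1 by rewrite /D addrAC subrr add0r.
by move: e0; move: (D x) => z z0; field.
Qed.

(* As [logistic' = - logistic * (1 - logistic)], all the derivatives are
   polynomials in [logistic]. *)
Definition logistic_poly (k : nat) : {poly R} :=
  iter k (fun p => - (p^`() * 'X * (1 - 'X))) 'X.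

Definition logistic_step (K c : R) (k : nat) (x : R) : R :=
  K ^+ k * (logistic_poly k).[logistic (K * (x - c))].

Lemma is_derive_logistic_step K c k (x : R) :
  is_derive x 1 (logistic_step K c k) (logistic_step K c k.+1 x).
Proof.
have dl : is_derive x 1 (fun y : R => K * (y - c)) K.
  by apply: is_derive_eq; rewrite /GRing.scale /=; ring.
pose z := K * (x - c); pose l := logistic z.
have dL : is_derive x 1 (fun y : R => logistic (K * (y - c)))
    (- (l * (1 - l)) * K).
  have dlog : is_derive z 1 logistic (- (l * (1 - l))).
    exact: is_derive_logistic.
  exact: (@is_derive1_comp _ logistic (fun y : R => K * (y - c))).
have dp : is_derive l 1 (horner (logistic_poly k)) (logistic_poly k)^`().[l].
  exact: is_derive_poly.
have dP : is_derive x 1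
    (fun y : R => (logistic_poly k).[logistic (K * (y - c))])
    ((logistic_poly k)^`().[l] * (- (l * (1 - l)) * K)).
  exact: (@is_derive1_comp _ (horner (logistic_poly k))
    (fun y : R => logistic (K * (y - c)))).
rewrite /logistic_step; apply: is_derive_eq.
rewrite /GRing.scale /= !hornerE -/z -/l exprS /=; ring.
Qed.

(** A polynomial evaluated in [[0, 1]] is bounded by the sum of the moduli of its coefficients, so
    every derivative is bounded on the whole line. *)
Lemma logistic_step_smooth_bounded K c : smooth_bounded (logistic_step K c).
Proof.
apply: derivatives_smooth_bounded => [k x|k].
  exact: is_derive_logistic_step.
exists (`|K ^+ k| * \sum_(i < size (logistic_poly k)) `|(logistic_poly k)`_i|).
move=> x; rewrite normrM ler_wpM2l// horner_coef.
apply: le_trans (ler_norm_sum _ _ _) _; apply: ler_sum => i _.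
rewrite normrM ler_piMr// normrX exprn_ile1//.
by rewrite (gtr0_norm (logistic_gt0 _)) logistic_le1.
Qed.

Lemma smooth_step_exists (c delta eps : R) : 0 < delta -> 0 < eps ->
  exists f : nat -> R -> R,
  [/\ (forall k (x : R), is_derive x 1 (f k) (f k.+1 x)),
     (forall x, 0 <= f 0 x <= 1), smooth_bounded f,
     (forall x, x <= c - delta -> 1 - eps <= f 0 x) &
     (forall x, c + delta <= x -> f 0 x <= eps)].
Proof.
move=> delta0 eps0.
(* At distance [delta] from [c] the argument of the logistic function is then at least [1 / eps] in
   modulus, and [exp y >= 1 + y] suffices to make the tail at most [eps]. *)
pose K := (eps * delta)^-1.
have K0 : 0 < K by rewrite invr_gt0 mulr_gt0.
have Kd : K * delta = eps^-1.
  by rewrite /K; field; rewrite !gt_eqF.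
have fE x : logistic_step K c 0 x = logistic (K * (x - c)).
  by rewrite /logistic_step expr0 mul1r hornerX.
have ei0 : 0 < eps^-1 by rewrite invr_gt0.
have E y : eps^-1 <= y -> (1 + expR y)^-1 <= eps.
  move=> ye; rewrite -[leRHS]invrK lef_pV2 ?posrE ?addr_gt0 ?expR_gt0//.
  by have := expR_ge1Dx y; lra.
exists (logistic_step K c); split.
- exact: is_derive_logistic_step.
- by move=> x; rewrite fE ltW ?logistic_gt0// logistic_le1.
- exact: logistic_step_smooth_bounded.
- move=> x xc; rewrite fE /logistic.
  set y := K * (x - c).
  have ye : eps^-1 <= - y by rewrite -Kd /y -mulrN ler_pM2l//; lra.
  have -> : (1 + expR y)^-1 = 1 - (1 + expR (- y))^-1.
    rewrite expRN; field; rewrite !gt_eqF ?expR_gt0 ?addr_gt0 ?expR_gt0//.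
  by rewrite lerD2l lerN2; exact: E.
- move=> x xc; rewrite fE; apply: E.
  by rewrite -Kd ler_pM2l//; lra.
Qed.

End Logistic.

(** * Expectation of a product of independent variables *)

Section IndependentProduct.
Context {d : measure_display} {T : measurableType d} {R : realType}.
Variable P : probability T R.

Definition independent_pair (Y Z : {RV P >-> R}) :=
  forall A B : set R, measurable A -> measurable B ->
    P (Y @^-1` A `&` Z @^-1` B) = (P (Y @^-1` A) * P (Z @^-1` B))%E.

(** The joint law agrees with the product of the marginals on rectangles, hence everywhere, and
    Fubini applies. With [Y] bounded, integrability of [Z] alone makes the product integrable. *)
Lemma Rintegral_independent_mul (Y Z : {RV P >-> R}) (M : R) :
  independent_pair Y Z -> (forall w, `|Y w| <= M) ->
  P.-integrable setT (EFin \o Z) ->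
  \int[P]_w (Y w * Z w) = \int[P]_w Y w * \int[P]_w Z w.
Proof.
move=> YZ YM intZ.
pose YZp w : R * R := (Y w, Z w).
have mYZ : measurable_fun setT YZp.
  by apply: measurable_fun_pair; exact: measurable_funPT.
pose YZi := isMeasurableFun.Build _ _ _ _ YZp mYZ.
pose YZf : {RV P >-> (R * R)%type} :=
  HB.pack YZp YZi.
pose DY : probability R R := distribution P Y.
pose DZ : probability R R := distribution P Z.
have DE C : measurable C -> (DY \x DZ)%E C = distribution P YZf C.
  by move=> mC; exact: (@product_measure_unique _ _ _ _ _ DY DZ (distribution P YZf) YZ C mC).
pose f (z : R * R) : R := z.1 * z.2.
have mf : measurable_fun setT f.
  by apply: measurable_funM; [exact: measurable_fst|exact: measurable_snd].
have intYZ : P.-integrable setT (EFin \o (fun w => Y w * Z w)).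
  apply: (@integrableMr _ _ _ P setT measurableT Y (EFin \o Z)) => //.
  by exists M; split; rewrite ?num_real// => N MN w _; exact: le_trans (YM w) (ltW MN).
have intD : (distribution P YZf).-integrable setT (EFin \o f).
  apply: integrable_pushforward => //.
  exact/measurable_EFinP.
have intp : (DY \x DZ)%E.-integrable setT (EFin \o f).
  move: intD => /integrableP[mEf fy]; apply/integrableP; split => //.
  apply: le_lt_trans fy; rewrite le_eqVlt; apply/orP; left; apply/eqP.
  by apply: eq_measure_integral => C mC _; exact: DE.
have intY : P.-integrable setT (EFin \o Y).
  by apply: (bounded_integrable P (M := M)) => //; exact: measurable_funPT.
have intDZ : DZ.-integrable setT (EFin \o (@id R)).
  by apply: integrable_pushforward => //; exact/measurable_EFinP.
have intDY : DY.-integrable setT (EFin \o (@id R)).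
  by apply: integrable_pushforward => //; exact/measurable_EFinP.
have E1 : (\int[P]_w (Y w * Z w)%:E = \int[(DY \x DZ)%E]_z (f z)%:E)%E.
  transitivity (\int[distribution P YZf]_z (f z)%:E)%E.
    rewrite (integral_distribution (X := YZf) (f := EFin \o f))//.
    exact/measurable_EFinP.
  by apply: eq_measure_integral => C mC _; exact/esym/DE.
have EY : \int[DY]_y y = \int[P]_w Y w.
  rewrite /Rintegral (integral_distribution (X := Y) (f := EFin \o (@id R)))//.
  exact/measurable_EFinP.
have EZ : \int[DZ]_y y = \int[P]_w Z w.
  rewrite /Rintegral (integral_distribution (X := Z) (f := EFin \o (@id R)))//.
  exact/measurable_EFinP.
rewrite {1}/Rintegral E1 -integral12_prod_meas1// -EY -EZ -RintegralZr//.
congr fine; apply: eq_integral => y _.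
rewrite /fubini_F /f /=.
under eq_integral do rewrite EFinM.
rewrite integralZl// EFinM /Rintegral fineK//.
exact: integrable_fin_num.
Qed.

End IndependentProduct.

(** * Independence of a partial sum from the next term *)

Section PartialSums.
Context {d : measure_display} {T : measurableType d} {R : realType}.
Variables (P : probability T R) (X : nat -> {RV P >-> R}).
Hypothesis X_indep : mutually_independent P X.

Definition partial_sum (n : nat) (w : T) : R := \sum_(j < n) X j w.

Lemma measurable_partial_sum n : measurable_fun setT (partial_sum n).
Proof. by apply: measurable_sum => j; exact: measurable_funP. Qed.

HB.instance Definition _ n :=
  isMeasurableFun.Build _ _ _ _ (partial_sum n) (measurable_partial_sum n).

(** Cylinder events of the variables from index [n] on. Finite intersections are all that mutual
    independence speaks about, and they are stable under adding a constraint on the preceding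
    variable. *)
Definition future_event (n : nat) (E : set T) :=
  exists (J : {fset nat}) (A : nat -> set R),
  [/\ forall i, i \in J -> (n <= i)%N, forall i, i \in J -> measurable (A i) &
      E = \bigcap_(i in [set` J]) (X i @^-1` A i)].

Lemma future_event_measurable n E : future_event n E -> measurable E.
Proof.
move=> [J [A [_ mA ->]]]; apply: fin_bigcap_measurable => [|i iJ].
  exact: finite_fset.
by rewrite -[X in measurable X]setTI; apply: measurable_funP => //; exact: mA.
Qed.

Lemma future_eventT n : future_event n setT.
Proof.
exists fset0, (fun=> setT); split => //.
by apply/seteqP; split.
Qed.

Lemma future_event_setI n E (B : set R) : measurable B ->
  future_event n.+1 E ->
  future_event n (X n @^-1` B `&` E) /\
  P (X n @^-1` B `&` E) = (P (X n @^-1` B) * P E)%E.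
Proof.
move=> mB [J [A [Jn mA EE]]].
have nJ : n \notin J by apply/negP => /Jn; rewrite ltnn.
pose A' i := if i == n then B else A i.
have mA' i : i \in (n |` J)%fset -> measurable (A' i).
  by rewrite !inE /A'; case: eqP => //= _; exact: mA.
have A'J i : i \in J -> A' i = A i.
  by rewrite /A'; case: eqP => // -> /(negP nJ).
have E' : X n @^-1` B `&` E = \bigcap_(i in [set` (n |` J)%fset]) (X i @^-1` A' i).
  rewrite EE; apply/seteqP; split => [w [wB wA] i /=|w wA].
    rewrite !inE => /orP[/eqP ->|iJ]; first by rewrite /A' eqxx.
    by rewrite /preimage /= A'J//; exact: wA.
  split; first by have := wA n; rewrite /= !inE eqxx /A' eqxx; exact.
  by move=> i iJ; have := wA i; rewrite /= !inE /preimage /= A'J//; apply; rewrite [i \in J]iJ orbT.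
split.
  exists (n |` J)%fset, A'; split => // i; rewrite !inE => /orP[/eqP ->//|/Jn].
  exact: ltnW.
rewrite E' X_indep// big_fsetU1//= {1}/A' eqxx EE X_indep//; congr (_ * _)%E.
by apply: eq_big_seq => i iJ; rewrite A'J.
Qed.

(** Independence from all future events, and not just from [X n], is what makes the induction work:
    when [X n] joins the sum, its constraint is read as part of a future event for the shorter
    sum. *)
Lemma partial_sum_independent n (E : set T) (B : set R) :
  future_event n E -> measurable B ->
  P (partial_sum n @^-1` B `&` E) = (P (partial_sum n @^-1` B) * P E)%E.
Proof.
elim: n E B => [|n IHn] E B nE mB.
  have [B0|B0] := pselect (B 0).
    have -> : partial_sum 0 @^-1` B = setT.
      by apply/seteqP; split => // w _; rewrite /preimage /= /partial_sum big_ord0.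
    by rewrite setTI probability_setT mul1e.
  have -> : partial_sum 0 @^-1` B = set0.
    by apply/seteqP; split => // w; rewrite /preimage /= /partial_sum big_ord0.
  by rewrite set0I measure0 mul0e.
have mE := future_event_measurable nE.
have fin_E : (0 <= fine (P E)) by exact: fine_ge0.
pose pr w : R * R := (partial_sum n w, X n w).
have mpr : measurable_fun setT pr.
  by apply: measurable_fun_pair; [exact: measurable_partial_sum|exact: measurable_funPT].
pose pri := isMeasurableFun.Build _ _ _ _ pr mpr.
pose prf : {RV P >-> (R * R)%type} := HB.pack pr pri.
(* As functions of the event for the pair (partial sum, next term), both sides of the claim are
   finite measures on the plane; they are compared on rectangles, a generating class stable under
   intersection. *)
have [m1 m1E] : exists m1 : {measure set (R * R) -> \bar R},
    forall C, m1 C = P (pr @^-1` C `&` E).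
  pose m1 mp : {measure set (R * R) -> \bar R} :=
    @measure_function_pushforward__canonical__measure_function_Measure
      _ _ _ _ _ (mrestr P mE) pr mp.
  by exists (m1 mpr).
have [m2 m2E] : exists m2 : {measure set (R * R) -> \bar R},
    forall C, m2 C = (P E * P (pr @^-1` C))%E.
  exists (mscale (NngNum fin_E) (distribution P prf)) => C.
  have PE_fin : P E \is a fin_num by exact: fin_num_measure.
  by rewrite /mscale /=; congr (_ * _)%E; exact: fineK.
pose G := [set C : set (R * R) | exists A1 A2 : set R,
  [/\ measurable A1, measurable A2 & C = A1 `*` A2]].
have m12 C : measurable C -> m1 C = m2 C.
  apply: (@measure_unique _ _ _ G (fun=> setT)).
  - rewrite measurable_prod_measurableType; congr (<<s _ >>).
    apply/seteqP; split => [_ [A1 mA1 [A2 mA2 <-]]|_ [A1 [A2 [mA1 mA2 ->]]]].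
      by exists A1, A2.
    by exists A1 => //; exists A2.
  - move=> _ _ [A1 [A2 [mA1 mA2 ->]]] [B1 [B2 [mB1 mB2 ->]]].
    rewrite -setXI; exists (A1 `&` B1), (A2 `&` B2).
    by split => //; exact: measurableI.
  - by move=> _; exists setT, setT; split => //; rewrite setXTT.
  - by rewrite bigcup_const.
  - move=> _ [A1 [A2 [mA1 mA2 ->]]].
    have [nE' PE'] := future_event_setI mA2 nE.
    have [n' P'] := future_event_setI mA2 (future_eventT n.+1).
    rewrite setIT in n'.
    rewrite m1E m2E.
    (* The constraint on [X n] moves into the future event, so that the induction hypothesis
       applies. *)
    transitivity (P (partial_sum n @^-1` A1 `&` (X n @^-1` A2 `&` E))).
      by rewrite setIA.
    rewrite IHn// PE'.
    have -> : pr @^-1` (A1 `*` A2) = partial_sum n @^-1` A1 `&` X n @^-1` A2 by [].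
    by rewrite IHn// muleA muleC.
  - move=> _; rewrite m1E preimage_setT setTI.
    exact: le_lt_trans (probability_le1 P mE) (ltry 1).
pose C := [set z : R * R | B (z.1 + z.2)].
have mC : measurable C.
  rewrite -[C]setTI.
  by apply: (measurable_funD measurable_fst measurable_snd).
have psE w : partial_sum n.+1 w = partial_sum n w + X n w.
  by rewrite /partial_sum big_ord_recr.
have := m12 _ mC; rewrite m1E m2E.
have -> : pr @^-1` C = partial_sum n.+1 @^-1` B.
  by apply/seteqP; split => w; rewrite /C /preimage /= psE.
by move=> ->; rewrite muleC.
Qed.

Lemma partial_sum_independent_pair n : independent_pair (partial_sum n) (X n).
Proof.
move=> A B mA mB.
have [nB PB] := future_event_setI mB (future_eventT n.+1).
by move: nB; rewrite setIT => nB; rewrite partial_sum_independent.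
Qed.

End PartialSums.

(** * Effect of one more term on a smooth expectation *)

Section OneStep.
Context {d : measure_display} {T : measurableType d} {R : realType}.
Variable P : probability T R.
Local Notation intg f := (P.-integrable setT (EFin \o f)).

Lemma integrable_addr (f g : T -> R) :
  intg f -> intg g -> intg (fun w => f w + g w).
Proof. by move=> intf intg'; exact: (integrableD measurableT intf intg'). Qed.

Lemma integrable_subr (f g : T -> R) :
  intg f -> intg g -> intg (fun w => f w - g w).
Proof. by move=> intf intg'; exact: (integrableB measurableT intf intg'). Qed.

Lemma integrable_scaler (f : T -> R) (r : R) :
  intg f -> intg (fun w => r * f w).
Proof. by move=> intf; exact: (integrableZl measurableT r intf). Qed.

Lemma integrable_bounded_mulr (f g : T -> R) (M : R) :
  measurable_fun setT f -> (forall w, `|f w| <= M) -> intg g ->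
  intg (fun w => f w * g w).
Proof.
move=> mf fM ig; apply: (@integrableMr _ _ _ P setT measurableT f (EFin \o g)) => //.
by exists M; split; rewrite ?num_real// => N MN w _; exact: le_trans (fM w) (ltW MN).
Qed.

Variables (Y X : {RV P >-> R}) (v : R).
Hypothesis YX_indep : independent_pair Y X.
Hypothesis X_int : intg X.
Hypothesis X_mean : \int[P]_w X w = 0.
Hypothesis X2_int : intg (fun w => X w ^+ 2).
Hypothesis X2_mean : \int[P]_w X w ^+ 2 = v.
Variables (f : nat -> R -> R) (M c : R).
Hypothesis f_smooth : smooth_bounded f.
Hypothesis fM : forall k, (k <= 4)%N -> taylor_bounds M f k.
Hypothesis c_gt0 : 0 < c.

Let mfE k (Z : T -> R) : measurable_fun setT Z ->
  measurable_fun setT (fun w => f k (Z w)).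
Proof. exact: (measurableT_comp (smooth_bounded_measurable k f_smooth)). Qed.

Let f_int k (Z : T -> R) : measurable_fun setT Z -> intg (fun w => f k (Z w)).
Proof.
move=> mZ; have [N _ fN] := f_smooth k.
apply: (bounded_integrable P (M := N)); first exact: mfE.
by move=> w; case: (fN (Z w) 0).
Qed.

Let mY : measurable_fun setT Y. Proof. exact: measurable_funPT. Qed.
Let mX : measurable_fun setT X. Proof. exact: measurable_funPT. Qed.
Let mYX : measurable_fun setT (fun w => Y w + c * X w).
Proof. by apply: measurable_funD => //; apply: measurable_funM. Qed.
Let mYXb b : measurable_fun setT (fun w => Y w + c * X w + b).
Proof. exact: measurable_funD. Qed.

Let fX_int k : intg (fun w => f k (Y w) * X w).
Proof.
have [N _ fN] := f_smooth k.
have fYN w : `|f k (Y w)| <= N by case: (fN (Y w) 0).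
exact: (integrable_bounded_mulr (mfE k mY) fYN X_int).
Qed.

Let fX2_int k : intg (fun w => f k (Y w) * X w ^+ 2).
Proof.
have [N _ fN] := f_smooth k.
have fYN w : `|f k (Y w)| <= N by case: (fN (Y w) 0).
exact: (integrable_bounded_mulr (mfE k mY) fYN X2_int).
Qed.

Let Rintegral_f_mul k (g : R -> R) : measurable_fun setT g ->
  intg (fun w => g (X w)) ->
  \int[P]_w (f k (Y w) * g (X w)) = \int[P]_w f k (Y w) * \int[P]_w g (X w).
Proof.
move=> mg ig.
have mfY : measurable_fun setT (fun w => f k (Y w)) by exact: mfE.
have mgX : measurable_fun setT (fun w => g (X w)) by exact: measurableT_comp.
pose fYi := isMeasurableFun.Build _ _ _ _ (fun w => f k (Y w)) mfY.
pose fY : {RV P >-> R} := HB.pack (fun w => f k (Y w)) fYi.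
pose gXi := isMeasurableFun.Build _ _ _ _ (fun w => g (X w)) mgX.
pose gX : {RV P >-> R} := HB.pack (fun w => g (X w)) gXi.
have [N _ fN] := f_smooth k.
apply: (@Rintegral_independent_mul _ _ _ P fY gX N) => //.
  move=> A B mA mB.
  have mfA : measurable (f k @^-1` A).
    by rewrite -[X in measurable X]setTI; exact: smooth_bounded_measurable.
  have mgB : measurable (g @^-1` B).
    by rewrite -[X in measurable X]setTI; exact: mg.
  exact: (YX_indep mfA mgB).
by move=> w; case: (fN (Y w) 0).
Qed.

Lemma Rintegral_smooth_mul k : \int[P]_w (f k (Y w) * X w) = 0.
Proof. by rewrite (Rintegral_f_mul k (g := id))// X_mean mulr0. Qed.

Lemma Rintegral_smooth_mul_sqr k :
  \int[P]_w (f k (Y w) * X w ^+ 2) = \int[P]_w f k (Y w) * v.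
Proof.
by rewrite (Rintegral_f_mul k (g := fun x => x ^+ 2))// X2_mean.
Qed.

Let normr_le_Rintegral (g h : T -> R) : intg g -> intg h ->
  (forall w, `|g w| <= h w) -> `|\int[P]_w g w| <= \int[P]_w h w.
Proof.
move=> ig ih gh; apply: (le_trans (le_normr_Rintegral _ ig)) => //.
by apply: le_Rintegral => //; exact: integrable_norm.
Qed.

(** The first-order term [c f'(Y) X] has mean zero by independence and centring, so the change is of
    order [c^2]; with [c = sqrt p] this is [p] instead of [sqrt p]. *)
Lemma one_step_centered k : (k <= 4)%N ->
  `|\int[P]_w f k (Y w + c * X w) - \int[P]_w f k (Y w)| <= M * c ^+ 2 * v.
Proof.
move=> k4.
have -> : \int[P]_w f k (Y w + c * X w) - \int[P]_w f k (Y w) =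
  \int[P]_w (f k (Y w + c * X w) - f k (Y w) - c * (f k.+1 (Y w) * X w)).
  rewrite RintegralB//; [|apply: integrable_subr; exact: f_int|
    apply: integrable_scaler; exact: fX_int].
  rewrite RintegralB//; [|exact: f_int|exact: f_int].
  by rewrite RintegralZl// Rintegral_smooth_mul mulr0 subr0.
rewrite -X2_mean -RintegralZl//; apply: normr_le_Rintegral.
- apply: integrable_subr; last by apply: integrable_scaler; exact: fX_int.
  by apply: integrable_subr; exact: f_int.
- exact: integrable_scaler.
- move=> w; have -> : c * (f k.+1 (Y w) * X w) = c * X w * f k.+1 (Y w) by ring.
  have -> : M * c ^+ 2 * X w ^+ 2 = M * (c * X w) ^+ 2 by ring.
  by case: (fM k4 (Y w) (c * X w)).
Qed.

Lemma one_step_le k b : (k <= 4)%N ->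
  `|\int[P]_w f k (Y w + c * X w + b) - \int[P]_w f k (Y w)| <=
    M * (`|b| + c ^+ 2 * v).
Proof.
move=> k4; rewrite -[X in `|X|](subrKA (\int[P]_w f k (Y w + c * X w))).
rewrite (le_trans (ler_normD _ _))// mulrDr lerD//; last first.
  by rewrite mulrA; exact: one_step_centered.
rewrite -RintegralB//; [|exact: f_int|exact: f_int].
apply: normr_Rintegral_le.
  by apply: measurable_funB; exact: mfE.
by move=> w; case: (fM k4 (Y w + c * X w) b).
Qed.

(** The third-order Taylor bound is affordable only where [|c X| < delta], since [X] has no third
    moment; elsewhere the second-order bound is used and leaves the truncated second moment of the
    Lindeberg condition. *)
Lemma one_step_expansion b delta : 0 < delta ->
  `|\int[P]_w f 0 (Y w + c * X w + b) - \int[P]_w f 0 (Y w)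
    - b * \int[P]_w f 1 (Y w) - c ^+ 2 * v / 2 * \int[P]_w f 2 (Y w)| <=
  M * b ^+ 2 + `|b| * (M * c ^+ 2 * v) + M * delta * (c ^+ 2 * v) +
  2 * M * (c ^+ 2 * \int[P]_w (X w ^+ 2 * \1_[set w' | delta / c <= `|X w'|] w)).
Proof.
move=> delta0.
have M0 : 0 <= M by case: (fM (leq0n _) 0 0) => + _ _ _; exact: le_trans.
pose V w := Y w + c * X w.
pose tail w := X w ^+ 2 * \1_[set w' | delta / c <= `|X w'|] w.
have m_tail : measurable [set w' | delta / c <= `|X w'|].
  rewrite -[X in measurable X]setTI.
  by apply: (measurable_fun_le (f := cst (delta / c))) => //; exact: measurableT_comp.
have tail_int : intg tail.
  rewrite (_ : tail = fun w => \1_[set w' | delta / c <= `|X w'|] w * X w ^+ 2); last first.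
    by apply/funext => w; rewrite /tail mulrC.
  apply: (integrable_bounded_mulr (M := 1)) => //.
  by move=> w; rewrite indicE; case: (_ \in _); rewrite ?normr1 ?normr0.
set A := (X in `|X|).
(* Three errors: the deterministic shift [b] started from [V], the exchange of [f 1 (V w)] for
   [f 1 (Y w)], and the random shift [c * X w]. *)
have A_split : A =
    \int[P]_w (f 0 (V w + b) - f 0 (V w) - b * f 1 (V w)) +
    b * (\int[P]_w f 1 (V w) - \int[P]_w f 1 (Y w)) +
    \int[P]_w (f 0 (V w) - f 0 (Y w) - c * (f 1 (Y w) * X w) -
      c ^+ 2 / 2 * (f 2 (Y w) * X w ^+ 2)).
  have i1 : intg (fun w => b * f 1 (V w)) by apply: integrable_scaler; exact: f_int.
  have i2 : intg (fun w => c * (f 1 (Y w) * X w)) by exact: integrable_scaler.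
  have i3 : intg (fun w => c ^+ 2 / 2 * (f 2 (Y w) * X w ^+ 2)).
    exact: integrable_scaler.
  have i4 : intg (fun w => f 0 (V w) - f 0 (Y w)).
    by apply: integrable_subr; exact: f_int.
  have i5 : intg (fun w => f 0 (V w) - f 0 (Y w) - c * (f 1 (Y w) * X w)).
    exact: integrable_subr.
  have i6 : intg (fun w => f 0 (V w + b) - f 0 (V w)).
    by apply: integrable_subr; apply: f_int => //; exact: mYXb.
  rewrite (RintegralB _ i5 i3)// (RintegralB _ i4 i2)// (RintegralB _ i6 i1)//.
  rewrite !RintegralZl//; [|exact: f_int].
  rewrite !RintegralB//; try by apply: f_int => //; exact: mYXb.
  rewrite Rintegral_smooth_mul Rintegral_smooth_mul_sqr /A /V.
  by field.
rewrite A_split -addrA -(addrA (_ + _)) -[X in _ <= X]addrA.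
apply: (le_trans (ler_normD _ _)); apply: lerD; last apply: (le_trans (ler_normD _ _)); last apply: lerD.
- apply: normr_Rintegral_le.
    apply: measurable_funB; first by apply: measurable_funB; apply: mfE => //; exact: mYXb.
    by apply: measurable_funM => //; exact: mfE.
  by move=> w; case: (fM (leq0n _) (V w) b).
- by rewrite normrM ler_wpM2l//; exact: one_step_centered.
- have -> : M * delta * (c ^+ 2 * v) + 2 * M * (c ^+ 2 * \int[P]_w tail w) =
      \int[P]_w (M * delta * c ^+ 2 * X w ^+ 2 + 2 * M * c ^+ 2 * tail w).
    rewrite RintegralD//; [|exact: integrable_scaler|exact: integrable_scaler].
    by rewrite !RintegralZl// X2_mean !mulrA.
  apply: normr_le_Rintegral.
  + apply: integrable_subr; last exact: integrable_scaler.
    apply: integrable_subr; last exact: integrable_scaler.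
    by apply: integrable_subr; exact: f_int.
  + by apply: integrable_addr; exact: integrable_scaler.
  + move=> w.
    have -> : f 0 (V w) - f 0 (Y w) - c * (f 1 (Y w) * X w) -
        c ^+ 2 / 2 * (f 2 (Y w) * X w ^+ 2) =
        f 0 (Y w + c * X w) - f 0 (Y w) - c * X w * f 1 (Y w) -
        (c * X w) ^+ 2 / 2 * f 2 (Y w) by rewrite /V; field.
    have [_ _ h2 h3] := fM (leq0n _) (Y w) (c * X w).
    have [tailw|tailw] := leP (delta / c) `|X w|.
      rewrite /tail indicE mem_set//= mulr1.
      have [f2 _ _ _] := fM (isT : (2 <= 4)%N) (Y w) 0.
      have -> : M * delta * c ^+ 2 * X w ^+ 2 + 2 * M * c ^+ 2 * X w ^+ 2 =
        M * delta * (c * X w) ^+ 2 + 2 * M * (c * X w) ^+ 2 by ring.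
      set h := c * X w in h2 *.
      have hh := sqr_ge0 h.
      apply: (@le_trans _ _ (M * h ^+ 2 + h ^+ 2 / 2 * M)); last first.
        have Mdh : 0 <= M * delta * h ^+ 2 by exact: mulr_ge0 (mulr_ge0 M0 (ltW delta0)) hh.
        have Mh : 0 <= M * h ^+ 2 by exact: mulr_ge0.
        by lra.
      rewrite (le_trans (ler_normB _ _))// lerD// normrM.
      have h20 : 0 <= h ^+ 2 / 2 by rewrite divr_ge0.
      by rewrite (ger0_norm h20) ler_wpM2l.
    (* Off the tail event, one factor [|c X|] of the cubic bound is replaced by [delta]. *)
    rewrite /tail indicE memNset/=; last by apply/negP; rewrite -ltNge.
    rewrite mulr0n !mulr0 addr0 (le_trans h3)//.
    have -> : M * delta * c ^+ 2 * X w ^+ 2 = M * (delta * (c * X w) ^+ 2) by ring.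
    rewrite ler_wpM2l// exprS -(real_normK (num_real (c * X w))).
    rewrite ler_wpM2r ?exprn_ge0// normrM (gtr0_norm c_gt0) ltW//.
    by rewrite mulrC -ltr_pdivlMr.
Qed.

End OneStep.

(** * Geometric averages of sequences known only in Cesaro mean *)

Section WeightedSums.
Context {R : realType}.
Implicit Types (p q : R) (c w g B : nat -> R).

(** Nonincreasing weights are mixtures of indicators of initial segments, so comparing partial sums
    is enough: this carries Cesaro information over to geometric averages. *)
Lemma ler_weighted_sum w (c1 c2 : nat -> R) N :
  (forall n, 0 <= w n) -> (forall n, w n.+1 <= w n) ->
  (forall n, \sum_(j < n) c1 j <= \sum_(j < n) c2 j) ->
  \sum_(n < N) w n * c1 n <= \sum_(n < N) w n * c2 n.
Proof.
move=> w0 wS c12.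
(* Keeping the final gap, weighted by [w N], is the strengthening that makes the induction on [N] go
   through. *)
suff : w N * (\sum_(j < N) c2 j - \sum_(j < N) c1 j) <=
    \sum_(n < N) w n * c2 n - \sum_(n < N) w n * c1 n.
  move=> H; rewrite -subr_ge0; apply: le_trans H.
  by rewrite mulr_ge0// subr_ge0.
elim: N => [|N IHN]; first by rewrite !big_ord0 subrr mulr0.
apply: (@le_trans _ _ (w N * (\sum_(j < N.+1) c2 j - \sum_(j < N.+1) c1 j))).
  by rewrite ler_wpM2r// subr_ge0.
rewrite !big_ord_recr /=; lra.
Qed.

Lemma sum_geometric p N : \sum_(n < N) (1 - p) ^+ n * p = 1 - (1 - p) ^+ N.
Proof.
elim: N => [|N IHN]; first by rewrite big_ord0 expr0 subrr.
by rewrite big_ord_recr /= IHN exprS; ring.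
Qed.

Lemma sum_geometric_le1 p N : 0 < p < 1 -> \sum_(n < N) (1 - p) ^+ n * p <= 1.
Proof.
move=> /andP[p0 p1]; rewrite sum_geometric lerBlDr lerDl exprn_ge0//.
by rewrite subr_ge0 ltW.
Qed.

Lemma sum_geometric_weight_le p c (K : R) N : 0 < p < 1 -> 0 <= K ->
  (forall n, \sum_(j < n) c j <= K * n%:R) ->
  \sum_(n < N) (1 - p) ^+ n * p * c n <= K.
Proof.
move=> p01 K0 cK; have /andP[p0 p1] := p01.
have q0 : 0 <= 1 - p by rewrite subr_ge0 ltW.
apply: (@le_trans _ _ (\sum_(n < N) (1 - p) ^+ n * p * K)).
  apply: (ler_weighted_sum (w := fun n => (1 - p) ^+ n * p) (c2 := fun=> K)).
  - by move=> n; rewrite mulr_ge0 ?exprn_ge0// ltW.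
  - move=> n; rewrite ler_wpM2r ?(ltW p0)// exprS ler_piMl ?exprn_ge0//.
    by rewrite gerBl ltW.
  - by move=> n; rewrite sumr_const card_ord -mulr_natr.
by rewrite -mulr_suml ler_piMl// sum_geometric_le1.
Qed.

(** Halving [p] pays for the linear factor: [1 - p <= (1 - p / 2)^2], and one of the two powers
    absorbs [(n + 1) p]. *)
Lemma natr_mul_geometric_le p n : 0 < p < 1 ->
  n.+1%:R * p * (1 - p) ^+ n <= 2 * (1 - p / 2) ^+ n.
Proof.
move=> /andP[p0 p1].
have r0 : 0 <= 1 - p / 2 by lra.
have r1 : 1 - p / 2 <= 1 by lra.
(* The last term of the geometric sum is its smallest. *)
have H m : m.+1%:R * (p / 2) * (1 - p / 2) ^+ m <= 1 - (1 - p / 2) ^+ m.+1.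
  rewrite -sum_geometric -mulrA mulr_natl -[m.+1 in leLHS]card_ord -sumr_const.
  apply: ler_sum => i _; rewrite mulrC ler_wpM2r ?divr_ge0// ?(ltW p0)//.
  by rewrite ler_wiXn2l// -ltnS.
have Hn : n.+1%:R * (p / 2) * (1 - p / 2) ^+ n <= 1.
  by rewrite (le_trans (H n))// gerBl exprn_ge0.
apply: (@le_trans _ _ (n.+1%:R * p * ((1 - p / 2) ^+ n * (1 - p / 2) ^+ n))).
  rewrite ler_wpM2l ?mulr_ge0 ?(ltW p0)// -exprMn lerXn2r ?nnegrE ?subr_ge0 ?(ltW p1)//.
    by rewrite mulr_ge0.
  by nra.
rewrite mulrA ler_wpM2r ?exprn_ge0//.
by move: Hn; set z := n.+1%:R; set y := _ ^+ n; lra.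
Qed.

(** One factor 2 comes from [natr_mul_geometric_le], the other from [p = 2 (p / 2)] when
    renormalizing the weights of parameter [p / 2]. *)
Lemma sum_geometric_weight_natr_le p c (K : R) N : 0 < p < 1 -> 0 <= K ->
  (forall n, 0 <= c n) -> (forall n, \sum_(j < n) c j <= K * n%:R) ->
  \sum_(n < N) (1 - p) ^+ n * p ^+ 2 * n.+1%:R * c n <= 4 * K.
Proof.
move=> p01 K0 c0 cK; have /andP[p0 p1] := p01.
have p201 : 0 < p / 2 < 1 by apply/andP; split; lra.
apply: (@le_trans _ _ (4 * \sum_(n < N) (1 - p / 2) ^+ n * (p / 2) * c n)).
  rewrite mulr_sumr; apply: ler_sum => n _.
  have := natr_mul_geometric_le n p01; move: (c0 n).
  set x := c n; set y := (1 - p) ^+ n; set z := (1 - p / 2) ^+ n.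
  move=> x0 H.
  have -> : y * p ^+ 2 * n.+1%:R * x = n.+1%:R * p * y * (p * x) by ring.
  have -> : 4 * (z * (p / 2) * x) = 2 * z * (p * x) by field.
  by rewrite ler_wpM2r// mulr_ge0// ltW.
by rewrite ler_wpM2l// sum_geometric_weight_le.
Qed.

(** With [q = 1 - p], the discounted difference [g n - q * g n.+1] is of order [p] as soon as [g] is
    bounded and varies slowly. *)
Lemma abel_summation (q : R) B g N : B 0 = 0 ->
  \sum_(n < N) q ^+ n * ((B n.+1 - B n) * g n) =
  q ^+ N * (B N * g N) + \sum_(n < N) q ^+ n * (B n.+1 * (g n - q * g n.+1)).
Proof.
move=> B0; elim: N => [|N IHN].
  by rewrite !big_ord0 B0 mul0r mulr0 addr0.
by rewrite !big_ord_recr /= IHN exprS; ring.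
Qed.

(** Disposes of the boundary terms of the truncated sums, and with [b = 0] of the mass of the
    geometric law beyond the truncation. *)
Lemma geometric_linear_vanish p (b c eps : R) : 0 < p < 1 -> 0 <= b -> 0 <= c ->
  0 < eps ->
  exists N0, forall N, (N0 <= N)%N -> (1 - p) ^+ N * (b * N%:R + c) <= eps.
Proof.
move=> p01 b0 c0 eps0; have /andP[p0 p1] := p01.
have r1 : `|1 - p / 2| < 1 by rewrite ger0_norm; lra.
have bc : 0 < 2 * (b + c + 1) by lra.
have e0 : 0 < eps * p / (2 * (b + c + 1)).
  exact: divr_gt0 (mulr_gt0 eps0 p0) bc.
have [N0 _ H] := (@cvgrPdist_le _ _ _ _ _ _ _).1 (cvg_expr r1) _ e0.
exists N0 => N N0N.
have := H N N0N; rewrite /= sub0r normrN ger0_norm; last first.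
  by rewrite exprn_ge0//; lra.
rewrite ler_pdivlMr//.
have := natr_mul_geometric_le N p01.
have : 0 <= (1 - p) ^+ N by rewrite exprn_ge0//; lra.
have : 0 <= (1 - p / 2) ^+ N by rewrite exprn_ge0//; lra.
have : 0 <= N%:R :> R by [].
rewrite -[N.+1%:R]natr1.
set y := (1 - p) ^+ N; set z := (1 - p / 2) ^+ N; set n := N%:R.
move=> n0 z0 y0 H1 H2.
rewrite -(ler_pM2l p0).
have : p * (y * (b * n + c)) <= (b + c) * ((n + 1) * p * y).
  have : 0 <= y * p * (b + c * n) by rewrite !mulr_ge0 ?addr_ge0 ?mulr_ge0// ltW.
  by lra.
have : (b + c) * ((n + 1) * p * y) <= (b + c) * (2 * z).
  exact: ler_wpM2l (addr_ge0 b0 c0) _ _ H1.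
by lra.
Qed.

(** The usable form of [o(n)]: multiplied by [p] and averaged geometrically, [eps n] gives [O(eps)]
    while [C] gives [C p]. The constant adds up the finitely many indices before the limit takes
    hold. *)
Lemma cesaro_bound (x : nat -> R) (l eps : R) : 0 < eps ->
  n%:R^-1 * (\sum_(j < n) x j) @[n --> \oo] --> l ->
  exists2 C, 0 <= C &
    forall n, `|\sum_(j < n) (x j - l)| <= eps * n%:R + C.
Proof.
move=> eps0 /cvgrPdist_le/(_ _ eps0)[n0 _ H].
exists (\sum_(m < n0) `|\sum_(j < m) (x j - l)|); first exact: sumr_ge0.
move=> n; have [nn0|n0n] := ltnP n n0.
  rewrite (bigD1 (Ordinal nn0))//= addrCA lerDl addr_ge0//.
    by rewrite mulr_ge0// ltW.
  exact: sumr_ge0.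
rewrite -[leLHS]addr0 lerD ?sumr_ge0//.
rewrite sumrB sumr_const card_ord -[l *+ n]mulr_natr.
have [->|n_gt0] := posnP n; first by rewrite big_ord0 !mulr0 subr0 normr0.
have n0' : 0 < n%:R :> R by rewrite ltr0n.
have := H n n0n; rewrite /= distrC => Hn.
have -> : \sum_(i < n) x i - l * n%:R = (n%:R^-1 * \sum_(i < n) x i - l) * n%:R.
  by rewrite mulrBl mulrAC mulVf ?mul1r ?gt_eqF.
by rewrite normrM (ger0_norm (ltW n0')) ler_wpM2r// ltW.
Qed.

Lemma cesaro_linear_bound (x : nat -> R) (l : R) :
  n%:R^-1 * (\sum_(j < n) x j) @[n --> \oo] --> l ->
  exists2 K, 0 <= K & forall n, \sum_(j < n) x j <= K * n%:R.
Proof.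
move=> /(cesaro_bound ltr01)[C C0 H].
exists (1 + C + `|l|); first by rewrite !addr_ge0.
case=> [|n]; first by rewrite big_ord0 mulr0.
have := H n.+1; rewrite sumrB sumr_const card_ord -[l *+ _]mulr_natr ler_norml => /andP[_].
have : 1 <= n.+1%:R :> R by rewrite ler1n.
have := ler_norm l; have := normr_ge0 l.
by set z := n.+1%:R; set y := \sum_(_ < _) _; nra.
Qed.

End WeightedSums.

(** * Deterministic telescoping along geometric weights *)

Section Telescoping.
Context {R : realType}.
Variables (p a s2 M K eps C delta L : R).
(** To be read as [e n = E u(T_n)], [e1 n = E u'(T_n)], [g n = E u''(T_n)], [ef n = E f(T_n)]; [s n]
    is a variance, [ell n] a Lindeberg term and [B n] a partial sum of the centred variances. *)
Variables (e e1 g ef s ell B : nat -> R) (N : nat).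
Hypotheses (p01 : 0 < p < 1) (M_ge0 : 0 <= M) (K_ge0 : 0 <= K).
Hypotheses (eps_ge0 : 0 <= eps) (C_ge0 : 0 <= C) (delta_ge0 : 0 <= delta).
Hypothesis s_ge0 : forall n, 0 <= s n.
Hypothesis sK : forall n, \sum_(j < n) (1 + s j) <= K * n%:R.
Hypothesis B0 : B 0 = 0.
Hypothesis BS : forall n, B n.+1 - B n = s n - s2.
Hypothesis B_le : forall n, `|B n| <= eps * n%:R + C.
Hypothesis e_le : forall n, `|e n| <= M.
Hypothesis g_le : forall n, `|g n| <= M.
Hypothesis eS : forall n, `|e n.+1 - e n| <= M * p * (1 + s n).
Hypothesis efS : forall n, `|ef n.+1 - ef n| <= M * p * (1 + s n).
Hypothesis gS : forall n, `|g n.+1 - g n| <= M * p * (1 + s n).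
Hypothesis efE : forall n, ef n = e n - a * e1 n - s2 / 2 * g n.
Hypothesis expansion : forall n,
  `|e n.+1 - e n - p * a * e1 n - p * s n / 2 * g n| <=
  M * (p ^+ 2 * (1 + s n) + delta * p * (1 + s n) + p * ell n).
Hypothesis ellL : \sum_(n < N) (1 - p) ^+ n * p * ell n <= L.

(** After summation by parts, [B n.+1], at most [eps (n + 1) + C], multiplies a difference of size
    [2 M p (1 + s n)]; the remaining factor [p] balances [n + 1]. *)
Lemma variance_fluctuation_bound :
  `|\sum_(n < N) (1 - p) ^+ n * (p / 2 * (s n - s2) * g n)| <=
  M * ((1 - p) ^+ N * (eps * N%:R + C) + eps * (4 * K) + C * p * K).
Proof.
have /andP[p_gt0 p_lt1] := p01.
have q_ge0 : 0 <= 1 - p by lra.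
have -> : \sum_(n < N) (1 - p) ^+ n * (p / 2 * (s n - s2) * g n) =
    p / 2 * \sum_(n < N) (1 - p) ^+ n * ((B n.+1 - B n) * g n).
  by rewrite mulr_sumr; apply: eq_bigr => n _; rewrite BS; ring.
rewrite abel_summation// normrM ger0_norm ?divr_ge0 ?(ltW p_gt0)//.
set A := (1 - p) ^+ N * (eps * N%:R + C).
have A_ge0 : 0 <= A by rewrite mulr_ge0 ?exprn_ge0// addr_ge0// mulr_ge0.
apply: (@le_trans _ _ (p / 2 * (M * A + \sum_(n < N)
    (1 - p) ^+ n * ((eps * n.+1%:R + C) * (2 * M * p * (1 + s n)))))).
  rewrite ler_wpM2l ?divr_ge0 ?(ltW p_gt0)//.
  apply: (le_trans (ler_normD _ _)); apply: lerD.
    rewrite !normrM (ger0_norm (exprn_ge0 _ _))// /A.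
    by rewrite [leRHS]mulrC -mulrA ler_wpM2l ?exprn_ge0// ler_pM.
  apply: (le_trans (ler_norm_sum _ _ _)); apply: ler_sum => n _.
  rewrite !normrM (ger0_norm (exprn_ge0 _ _))// ler_wpM2l ?exprn_ge0//.
  apply: ler_pM => //; have -> : g n - (1 - p) * g n.+1 =
      - (g n.+1 - g n) + p * g n.+1 by ring.
  rewrite (le_trans (ler_normD _ _))// normrN normrM (ger0_norm (ltW p_gt0)).
  have := gS n; have : p * `|g n.+1| <= p * M by rewrite ler_wpM2l// ltW.
  have : 0 <= M * p * s n by rewrite !mulr_ge0// ltW.
  by lra.
have -> : \sum_(n < N) (1 - p) ^+ n * ((eps * n.+1%:R + C) * (2 * M * p * (1 + s n))) =
  2 * M * eps * (\sum_(n < N) (1 - p) ^+ n * p * n.+1%:R * (1 + s n)) +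
  2 * M * C * (\sum_(n < N) (1 - p) ^+ n * p * (1 + s n)).
  rewrite !mulr_sumr -big_split /=; apply: eq_bigr => n _; ring.
have c_ge0 n : 0 <= 1 + s n by rewrite addr_ge0.
have := sum_geometric_weight_le (c := fun j => 1 + s j) N p01 K_ge0 sK.
have := sum_geometric_weight_natr_le (c := fun j => 1 + s j) N p01 K_ge0 c_ge0 sK.
set S1 := \sum_(n < N) _; set S2 := \sum_(n < N) (1 - p) ^+ n * p * (1 + s n).
have -> : S1 = p * \sum_(n < N) (1 - p) ^+ n * p * n.+1%:R * (1 + s n).
  by rewrite mulr_sumr; apply: eq_bigr => n _; ring.
set S3 := \sum_(n < N) _ => H1 H2.
have -> : p / 2 * (M * A + (2 * M * eps * S3 + 2 * M * C * S2)) =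
  M * (p / 2 * A + eps * (p * S3) + C * p * S2) by field.
rewrite ler_wpM2l// !lerD// ?ler_wpM2l ?mulr_ge0 ?(ltW p_gt0)//.
by rewrite ler_piMl//; lra.
Qed.

Lemma telescoped_sum_bound :
  `|\sum_(n < N) (1 - p) ^+ n * p * ef n.+1 - e 0| <=
  M * ((1 - p) ^+ N * (1 + eps * N%:R + C) + (3 + C) * p * K + delta * K +
    4 * eps * K + L).
Proof.
have /andP[p_gt0 p_lt1] := p01.
have q_ge0 : 0 <= 1 - p by lra.
(* Eliminating [e1] between [efE] and [r] gives [p ef n = e n - (1 - p) e n.+1 - p (e n.+1 - e n) +
   r n + p / 2 (s n - s2) g n], whose first two terms telescope under the weights. The term
   [ef n.+1 - ef n] in [tel] accounts for sums that start with one summand. *)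
pose r n := e n.+1 - e n - p * a * e1 n - p * s n / 2 * g n.
have tel m : \sum_(n < m) (1 - p) ^+ n * p * ef n.+1 - e 0 =
    - (1 - p) ^+ m * e m +
    (\sum_(n < m) (1 - p) ^+ n *
       (p * (ef n.+1 - ef n) + r n - p * (e n.+1 - e n)) +
     \sum_(n < m) (1 - p) ^+ n * (p / 2 * (s n - s2) * g n)).
  rewrite -big_split /=; elim: m => [|m IHm].
    by rewrite !big_ord0 expr0; ring.
  by rewrite !big_ord_recr /= addrAC IHm (efE m) /r exprS; field.
rewrite tel; apply: (le_trans (ler_normD _ _)).
apply: (@le_trans _ _ ((1 - p) ^+ N * M + (M * (3 * p * K + delta * K + L) +
  M * ((1 - p) ^+ N * (eps * N%:R + C) + eps * (4 * K) + C * p * K)))); last first.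
  by rewrite le_eqVlt; apply/orP; left; apply/eqP; ring.
apply: lerD.
  by rewrite mulNr normrN normrM (ger0_norm (exprn_ge0 _ _))// ler_wpM2l ?exprn_ge0.
apply: (le_trans (ler_normD _ _)); apply: lerD; last exact: variance_fluctuation_bound.
apply: (le_trans (ler_norm_sum _ _ _)).
apply: (@le_trans _ _ (M * (3 * p * (\sum_(n < N) (1 - p) ^+ n * p * (1 + s n)) +
    delta * (\sum_(n < N) (1 - p) ^+ n * p * (1 + s n)) +
    \sum_(n < N) (1 - p) ^+ n * p * ell n))).
  rewrite !mulr_sumr -!big_split /= mulr_sumr; apply: ler_sum => n _.
  rewrite normrM (ger0_norm (exprn_ge0 _ _))//.
  have -> : M * (3 * p * ((1 - p) ^+ n * p * (1 + s n)) +
     delta * ((1 - p) ^+ n * p * (1 + s n)) + (1 - p) ^+ n * p * ell n) =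
    (1 - p) ^+ n * (p * (M * p * (1 + s n)) +
     M * (p ^+ 2 * (1 + s n) + delta * p * (1 + s n) + p * ell n) +
     p * (M * p * (1 + s n))) by ring.
  rewrite ler_wpM2l ?exprn_ge0// (le_trans (ler_normB _ _))// lerD//.
    rewrite (le_trans (ler_normD _ _))// lerD//; last exact: expansion.
    by rewrite normrM (ger0_norm (ltW p_gt0)) ler_wpM2l// ltW.
  by rewrite normrM (ger0_norm (ltW p_gt0)) ler_wpM2l// ltW.
have SK := sum_geometric_weight_le (c := fun j => 1 + s j) N p01 K_ge0 sK.
rewrite ler_wpM2l// !lerD// ?ler_wpM2l ?mulr_ge0 ?(ltW p_gt0)//.
Qed.

End Telescoping.

(** * Moments of a centred variable *)

Section Moments.
Context {d : measure_display} {T : measurableType d} {R : realType}.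
Variables (P : probability T R) (Z : {RV P >-> R}) (v : R).
Hypothesis Z_mean : ('E_P[Z] = 0)%E.
Hypothesis Z_var : ('V_P[Z] = v%:E)%E.

Lemma integrable_of_fin_num (g : T -> R) : measurable_fun setT g ->
  (\int[P]_w (g w)%:E)%E \is a fin_num -> P.-integrable setT (EFin \o g).
Proof.
move=> mg gfin; apply/integrableP; split; first exact/measurable_EFinP.
by rewrite integral_fin_num_abs.
Qed.

Lemma centered_integrable : P.-integrable setT (EFin \o Z).
Proof.
by apply: integrable_of_fin_num; rewrite -?expectation_def ?Z_mean.
Qed.

Lemma centered_Rintegral : \int[P]_w Z w = 0.
Proof. by rewrite /Rintegral -expectation_def Z_mean. Qed.

Lemma centered_sqr_integral : (\int[P]_w (Z w ^+ 2)%:E = v%:E)%E.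
Proof.
rewrite -Z_var /variance unlock Z_mean /= unlock /=.
apply: eq_integral => w _; rewrite /GRing.mul /=.
by rewrite subr0.
Qed.

Lemma centered_sqr_integrable : P.-integrable setT (EFin \o (fun w => Z w ^+ 2)).
Proof.
apply: integrable_of_fin_num; last by rewrite centered_sqr_integral.
by apply: measurable_funX; exact: measurable_funPT.
Qed.

Lemma centered_sqr_Rintegral : \int[P]_w Z w ^+ 2 = v.
Proof. by rewrite /Rintegral centered_sqr_integral. Qed.

End Moments.

(** * Scaled partial sums with deterministic drift *)

Section ShiftedSums.
Context {d : measure_display} {T : measurableType d} {R : realType}.
Variables (P : probability T R) (X : nat -> {RV P >-> R}).

(** The drift [b] is arbitrary so that the sums with the true [a_j] and those with the constant [a]
    are both instances. *)
Definition shifted_sum (c : R) (b : nat -> R) (n : nat) (w : T) : R :=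
  c * partial_sum X n w + b n.

Lemma measurable_shifted_sum c b n : measurable_fun setT (shifted_sum c b n).
Proof.
by apply: measurable_funD => //; apply: measurable_funM.
Qed.

HB.instance Definition _ c b n :=
  isMeasurableFun.Build _ _ _ _ (shifted_sum c b n)
    (measurable_shifted_sum c b n).

Lemma shifted_sumS c (b : R) n w :
  shifted_sum c (fun n => b * n%:R) n.+1 w =
  shifted_sum c (fun n => b * n%:R) n w + c * X n w + b.
Proof. by rewrite /shifted_sum /partial_sum big_ord_recr /= -natr1; ring. Qed.

Lemma shifted_sum_independent_pair c b n : mutually_independent P X ->
  independent_pair (shifted_sum c b n) (X n).
Proof.
move=> X_indep A B mA mB.
pose l (x : R) := c * x + b n.
have ml : measurable_fun setT l.
  by apply: measurable_funD => //; apply: measurable_funM.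
have mlA : measurable (l @^-1` A) by rewrite -[X in measurable X]setTI; exact: ml.
exact: (partial_sum_independent_pair X_indep n mlA mB).
Qed.

End ShiftedSums.

(** * Limit of geometric averages of smooth expectations *)

Section Limit.
Context {d : measure_display} {T : measurableType d} {R : realType}.
Variables (P : probability T R) (X : nat -> {RV P >-> R}) (s a_ : nat -> R).
Variables (sigma2 a : R) (mu : probability (measurableTypeR R) R).
Hypothesis X_indep : mutually_independent P X.
Hypothesis X_mean : forall j, ('E_P[X j] = 0)%E.
Hypothesis X_var : forall j, ('V_P[X j] = (s j ^+ 2)%:E)%E.
Hypothesis s_mean : n%:R^-1 * (\sum_(j < n) s j ^+ 2) @[n --> \oo] --> sigma2.
Hypothesis a_mean : n%:R^-1 * (\sum_(j < n) a_ j) @[n --> \oo] --> a.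
Hypothesis lindeberg : forall eps : R, 0 < eps ->
  (fun p : R => \sum_(0 <= j <oo) (((1 - p) ^+ j * p)%R%:E *
     'E_P[fun w => (X j w ^+ 2 *
            \1_[set w' | (eps / Num.sqrt p <= `|X j w'|)%R] w)%R]))%E
    @ (0 : R)^'+ --> 0%E.
Hypothesis mu_resolvent : resolvent_law a sigma2 mu.

Let tail (eps p : R) (j : nat) : R :=
  \int[P]_w (X j w ^+ 2 * \1_[set w' | eps / Num.sqrt p <= `|X j w'|] w).

Lemma measurable_normr_ge (Z : {RV P >-> R}) (r : R) :
  measurable [set w | r <= `|Z w|].
Proof.
rewrite -[X in measurable X]setTI.
apply: (measurable_fun_le (f := cst r)) => //.
by apply: measurableT_comp => //; exact: measurable_funPT.
Qed.

Let tail_integrable (r : R) j : P.-integrable setT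
  (EFin \o (fun w => X j w ^+ 2 * \1_[set w' | r <= `|X j w'|] w)).
Proof.
have m1 : measurable_fun setT (\1_[set w' | r <= `|X j w'|] : T -> R).
  by apply: measurable_indic; exact: measurable_normr_ge.
have b1 w : `|(\1_[set w' | r <= `|X j w'|] w : R)| <= 1.
  by rewrite indicE; case: (_ \in _); rewrite ?normr1 ?normr0.
have := integrable_bounded_mulr m1 b1 (centered_sqr_integrable (X_mean j) (X_var j)).
by under eq_fun do rewrite mulrC.
Qed.

(** The terms are nonnegative, so the whole series bounds its truncations, uniformly in [N]. *)
Let lindeberg_near (eps L : R) : 0 < eps -> 0 < L ->
  \forall p \near (0 : R)^'+,
    forall N, \sum_(n < N) (1 - p) ^+ n * p * tail eps p n <= L.
Proof.
move=> eps0 L0.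
have near_lt : \forall p \near (0 : R)^'+,
    (\sum_(0 <= j <oo) (((1 - p) ^+ j * p)%R%:E *
     'E_P[fun w => (X j w ^+ 2 *
            \1_[set w' | (eps / Num.sqrt p <= `|X j w'|)%R] w)%R]) < L%:E)%E.
  have L0E : (0 < L%:E)%E by rewrite lte_fin.
  exact: (lindeberg eps0 (open_ereal_lt' L0E)).
near=> p => N.
have p0 : 0 < p by near: p; exact: nbhs_right_gt.
have p1 : p < 1 by near: p; exact: nbhs_right_lt.
have q0 : 0 <= 1 - p by rewrite subr_ge0 ltW.
have tailE j : 'E_P[fun w => (X j w ^+ 2 *
    \1_[set w' | (eps / Num.sqrt p <= `|X j w'|)%R] w)%R]%E = (tail eps p j)%:E.
  rewrite unlock /tail /Rintegral fineK//.
  exact: (integrable_fin_num measurableT (tail_integrable (eps / Num.sqrt p) j)).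
have tail_ge0 j : 0 <= tail eps p j.
  by apply: Rintegral_ge0 => w _; rewrite mulr_ge0 ?sqr_ge0.
have : (\sum_(0 <= j <oo) ((1 - p) ^+ j * p * tail eps p j)%:E < L%:E)%E.
  have H : (\sum_(0 <= j <oo) (((1 - p) ^+ j * p)%R%:E *
     'E_P[fun w => (X j w ^+ 2 *
            \1_[set w' | (eps / Num.sqrt p <= `|X j w'|)%R] w)%R]) < L%:E)%E.
    by near: p.
  by rewrite (eq_eseriesr (fun j _ => congr1 _ (tailE j))) in H.
move=> H; rewrite -lee_fin -sumEFin; apply: le_trans (ltW H).
rewrite -(big_mkord xpredT (fun n => ((1 - p) ^+ n * p * tail eps p n)%:E)).
apply: nneseries_lim_ge => n _ _.
by rewrite lee_fin mulr_ge0// mulr_ge0 ?exprn_ge0// ltW.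
Unshelve. all: by end_near. Qed.

Let conv (f : nat -> R -> R) (k : nat) (x : R) := \int[mu]_y f k (x + y).

(** The resolvent property of [mu] applied to the translate of [f 0] by [x], whose value at 0 is
    [f 0 x]. As [conv f k] integrates [f k], nothing is differentiated under the integral. *)
Let conv_resolvent (f : nat -> R -> R) (x : R) :
  (forall k (x : R), is_derive x 1 (f k) (f k.+1 x)) -> smooth_bounded f ->
  f 0 x = conv f 0 x - a * conv f 1 x - sigma2 / 2 * conv f 2 x.
Proof.
move=> df sf; have [M M0 fM] := smooth_bounded_uniform 2 sf.
have fb k z : (k <= 2)%N -> `|f k z| <= M by move=> k2; case: (fM k k2 z 0).
have mfx k : measurable_fun setT (fun y : measurableTypeR R => f k (x + y)).
  apply: (measurableT_comp (smooth_bounded_measurable k sf)).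
  by apply: measurable_funD.
have ifx k : (k <= 2)%N -> mu.-integrable setT (EFin \o (fun y => f k (x + y))).
  by move=> k2; apply: (bounded_integrable mu (mfx k) (M := M)) => y; exact: fb.
have dshift k (y : R) : is_derive y 1 (fun h => f k (x + h)) (f k.+1 (x + y)).
  have dl : is_derive y 1 (fun h : R => x + h) 1.
    by apply: is_derive_eq; rewrite add0r mul1r.
  rewrite -[f k.+1 _]mulr1.
  exact: (@is_derive1_comp _ (f k) (fun h : R => x + h)).
have cshift : continuous (fun y => f 2 (x + y)).
  move=> y; apply: (@continuous_comp _ _ _ (fun y : R => x + y) (f 2)).
    by apply: cvgD; [exact: cvg_cst|exact: cvg_id].
  exact: smooth_bounded_continuous.
have := mu_resolvent (dshift 0) (dshift 1) cshift (fun y => fb 0 (x + y) isT)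
  (fun y => fb 1 (x + y) isT) (fun y => fb 2 (x + y) isT).
rewrite addr0 => <-; rewrite /conv -!RintegralZl ?ifx// -RintegralB ?ifx//; last first.
  by apply: integrable_scaler; exact: ifx.
rewrite -RintegralB//; last by apply: integrable_scaler; exact: ifx.
by apply: integrable_subr; [exact: ifx|apply: integrable_scaler; exact: ifx].
Qed.

(** [S] has the constant drift of the resolvent equation, [S'] below the actual one. *)
Let S (p : R) n := shifted_sum X (Num.sqrt p) (fun n => p * a * n%:R) n.
Let S' (p : R) n := shifted_sum X (Num.sqrt p) (fun n => p * \sum_(j < n) a_ j) n.

Let geometric_mean_bound (f : nat -> R -> R) (M K eps C delta L p : R) N :
  0 < p < 1 ->
  (forall k (x : R), is_derive x 1 (f k) (f k.+1 x)) -> smooth_bounded f ->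
  0 <= M ->
  (forall k, (k <= 4)%N -> taylor_bounds M f k) ->
  (forall k, (k <= 4)%N -> taylor_bounds M (conv f) k) ->
  1 <= K -> (forall n, \sum_(j < n) (1 + s j ^+ 2) <= K * n%:R) ->
  0 <= eps -> 0 <= C -> 0 < delta ->
  (forall n, `|\sum_(j < n) (s j ^+ 2 - sigma2)| <= eps * n%:R + C) ->
  (forall n, `|\sum_(j < n) (a_ j - a)| <= eps * n%:R + C) ->
  \sum_(n < N) (1 - p) ^+ n * p * tail delta p n <= L ->
  `|\sum_(n < N) (1 - p) ^+ n * p * (\int[P]_w f 0 (S' p n.+1 w)) -
     \int[mu]_y f 0 y| <=
  2 * M * (1 + `|a| + a ^+ 2) * ((1 - p) ^+ N * (1 + eps * N%:R + C) +
    (4 + 2 * C) * p * K + delta * K + 8 * eps * K + L).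
Proof.
move=> p01 df sf M0 fM uM K1 sK eps0 C0 delta0 sB aB tailL.
have /andP[p_gt0 p_lt1] := p01.
have su : smooth_bounded (conv f) by exact: smooth_bounded_convolution.
have sp_gt0 : 0 < Num.sqrt p by rewrite sqrtr_gt0.
have sp2 : Num.sqrt p ^+ 2 = p by rewrite sqr_sqrtr// ltW.
pose A := 1 + `|a| + a ^+ 2.
have a0 := normr_ge0 a; have aa0 := sqr_ge0 a.
(* One constant for all the estimates: [a ^+ 2] and [|a|] come from the shift [p * a] in the
   one-step bounds, the factor 2 from the tail term. *)
pose M' := 2 * M * A.
have M'0 : 0 <= M' by rewrite !mulr_ge0// /A; lra.
have q0 : 0 <= 1 - p by lra.
have mS n : measurable_fun setT (S p n) by exact: measurable_shifted_sum.
have mS' n : measurable_fun setT (S' p n) by exact: measurable_shifted_sum.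
have X1 j := centered_integrable (X_mean j).
have X0 j := centered_Rintegral (X_mean j).
have X2 j := centered_sqr_integrable (X_mean j) (X_var j).
have Xv j := centered_sqr_Rintegral (X_mean j) (X_var j).
have SX n : independent_pair (S p n) (X n) by exact: shifted_sum_independent_pair.
have SS n w : S p n.+1 w = S p n w + Num.sqrt p * X n w + p * a.
  exact: shifted_sumS.
have step g k n : smooth_bounded g -> (forall k, (k <= 4)%N -> taylor_bounds M g k) ->
    (k <= 4)%N ->
    `|\int[P]_w g k (S p n.+1 w) - \int[P]_w g k (S p n w)| <=
      M' * p * (1 + s n ^+ 2).
  move=> sg gM k4; under eq_Rintegral do rewrite SS.
  have := one_step_le (SX n) (X1 n) (X0 n) (X2 n) (Xv n) (Num.sqrt p) sg gM (p * a) k4.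
  move=> /le_trans; apply.
  rewrite sp2 normrM (gtr0_norm p_gt0) /M' /A.
  have Mp : 0 <= M * p by rewrite mulr_ge0// ltW.
  have -> : M * (p * `|a| + p * s n ^+ 2) = M * p * (`|a| + s n ^+ 2) by ring.
  have -> : 2 * M * (1 + `|a| + a ^+ 2) * p * (1 + s n ^+ 2) =
    M * p * (2 * ((1 + `|a| + a ^+ 2) * (1 + s n ^+ 2))) by ring.
  by rewrite ler_wpM2l//; have := sqr_ge0 (s n); nra.
have gb g k n : smooth_bounded g -> (forall k, (k <= 4)%N -> taylor_bounds M g k) ->
    (k <= 4)%N -> `|\int[P]_w g k (S p n w)| <= M'.
  move=> sg gM k4; apply: (@le_trans _ _ M).
    apply: normr_Rintegral_le.
      exact: (measurableT_comp (smooth_bounded_measurable k sg)).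
    by move=> w; case: (gM k k4 (S p n w) 0).
  by rewrite /M' /A -mulrA mulrCA ler_peMr//; lra.
have intS k n : P.-integrable setT (EFin \o (fun w => conv f k (S p n w))).
  have [N0 _ cN] := su k.
  apply: (bounded_integrable P (M := N0)).
    exact: (measurableT_comp (smooth_bounded_measurable k su)).
  by move=> w; case: (cN (S p n w) 0).
have Hef n : \int[P]_w f 0 (S p n w) = \int[P]_w conv f 0 (S p n w) -
    a * \int[P]_w conv f 1 (S p n w) - sigma2 / 2 * \int[P]_w conv f 2 (S p n w).
  rewrite -!RintegralZl// -RintegralB//; last exact: integrable_scaler.
  rewrite -RintegralB//; [|by apply: integrable_subr => //; exact: integrable_scaler
    |exact: integrable_scaler].
  by apply: eq_Rintegral => w _; exact: conv_resolvent.
have Hexp n : `|\int[P]_w conv f 0 (S p n.+1 w) - \int[P]_w conv f 0 (S p n w) -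
    p * a * \int[P]_w conv f 1 (S p n w) -
    p * s n ^+ 2 / 2 * \int[P]_w conv f 2 (S p n w)| <=
    M' * (p ^+ 2 * (1 + s n ^+ 2) + delta * p * (1 + s n ^+ 2) + p * tail delta p n).
  under eq_Rintegral do rewrite SS.
  have := one_step_expansion (SX n) (X1 n) (X0 n) (X2 n) (Xv n) su uM sp_gt0
    (p * a) delta0.
  rewrite sp2 => /le_trans; apply; rewrite -/(tail delta p n).
  have tail0 : 0 <= tail delta p n.
    by apply: Rintegral_ge0 => w _; rewrite mulr_ge0 ?sqr_ge0.
  rewrite normrM (gtr0_norm p_gt0).
  have s0 := sqr_ge0 (s n).
  have -> : M * (p * a) ^+ 2 + p * `|a| * (M * p * s n ^+ 2) +
    M * delta * (p * s n ^+ 2) + 2 * M * (p * tail delta p n) =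
    M * (p ^+ 2 * (a ^+ 2 + `|a| * s n ^+ 2) + delta * p * s n ^+ 2 +
      2 * (p * tail delta p n)) by ring.
  have -> : M' * (p ^+ 2 * (1 + s n ^+ 2) + delta * p * (1 + s n ^+ 2) + p * tail delta p n)
    = M * (p ^+ 2 * (2 * A * (1 + s n ^+ 2)) + delta * p * (2 * A * (1 + s n ^+ 2)) +
       2 * A * (p * tail delta p n)) by rewrite /M'; ring.
  rewrite ler_wpM2l// lerD ?lerD//.
  - by rewrite ler_wpM2l ?sqr_ge0// /A; nra.
  - by rewrite ler_wpM2l ?(mulr_ge0 (ltW delta0) (ltW p_gt0))// /A; nra.
  - by rewrite ler_wpM2r ?(mulr_ge0 (ltW p_gt0))// /A; lra.
have s20 n : 0 <= s n ^+ 2 by exact: sqr_ge0.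
have K0 : 0 <= K by lra.
have B0 : \sum_(j < 0) (s j ^+ 2 - sigma2) = 0 by rewrite big_ord0.
have BS n : \sum_(j < n.+1) (s j ^+ 2 - sigma2) - \sum_(j < n) (s j ^+ 2 - sigma2) =
    s n ^+ 2 - sigma2.
  by rewrite big_ord_recr /= addrAC subrr add0r.
have := @telescoped_sum_bound R p a sigma2 M' K eps C delta L
  (fun n => \int[P]_w conv f 0 (S p n w)) (fun n => \int[P]_w conv f 1 (S p n w))
  (fun n => \int[P]_w conv f 2 (S p n w)) (fun n => \int[P]_w f 0 (S p n w))
  (fun n => s n ^+ 2) (tail delta p) (fun n => \sum_(j < n) (s j ^+ 2 - sigma2)) N
  p01 M'0 K0 eps0 C0 (ltW delta0) s20 sK B0 BS sB
  (fun n => gb _ 0 n su uM isT) (fun n => gb _ 2 n su uM isT)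
  (fun n => step _ 0 n su uM isT) (fun n => step _ 0 n sf fM isT)
  (fun n => step _ 2 n su uM isT) Hef Hexp tailL.
(* The empty sum is 0, so the initial value of the telescoping is [u(0)]. *)
have -> : \int[P]_w conv f 0 (S p 0 w) = \int[mu]_y f 0 y.
  rewrite -[RHS](Rintegral_probability_cst P); apply: eq_Rintegral => w _.
  rewrite /conv /S /shifted_sum /partial_sum big_ord0 !mulr0 addr0.
  by apply: eq_Rintegral => y _; rewrite add0r.
move=> tele.
have drift : `|\sum_(n < N) (1 - p) ^+ n * p * (\int[P]_w f 0 (S' p n.+1 w)) -
    \sum_(n < N) (1 - p) ^+ n * p * (\int[P]_w f 0 (S p n.+1 w))| <=
    M' * (4 * eps + C * p).
  rewrite -sumrB; apply: (le_trans (ler_norm_sum _ _ _)).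
  apply: (@le_trans _ _ (M * (eps * (\sum_(n < N) (1 - p) ^+ n * p ^+ 2 * n.+1%:R * 1) +
      C * p * \sum_(n < N) (1 - p) ^+ n * p))).
    rewrite !mulr_sumr -big_split /= mulr_sumr; apply: ler_sum => n _.
    rewrite -mulrBr normrM (ger0_norm (mulr_ge0 (exprn_ge0 _ q0) (ltW p_gt0))).
    have -> : M * (eps * ((1 - p) ^+ n * p ^+ 2 * n.+1%:R * 1) +
      C * p * ((1 - p) ^+ n * p)) =
      (1 - p) ^+ n * p * (M * (p * (eps * n.+1%:R + C))) by ring.
    rewrite ler_wpM2l ?mulr_ge0 ?exprn_ge0// ?(ltW p_gt0)//.
    have intf (Z : T -> R) : measurable_fun setT Z ->
        P.-integrable setT (EFin \o (fun w => f 0 (Z w))).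
      move=> mZ; apply: (bounded_integrable P (M := M)).
        exact: (measurableT_comp (smooth_bounded_measurable 0 sf)).
      by move=> w; case: (fM 0 isT (Z w) 0).
    rewrite -RintegralB//; [|exact: intf|exact: intf].
    apply: normr_Rintegral_le.
      by apply: measurable_funB;
        exact: (measurableT_comp (smooth_bounded_measurable 0 sf)).
    move=> w.
    have -> : S' p n.+1 w = S p n.+1 w + p * \sum_(j < n.+1) (a_ j - a).
      rewrite sumrB sumr_const card_ord -[a *+ _]mulr_natr.
      by rewrite /S' /S /shifted_sum; ring.
    have [_ + _ _] := fM 0 isT (S p n.+1 w) (p * \sum_(j < n.+1) (a_ j - a)).
    move=> /le_trans; apply; rewrite ler_wpM2l// normrM (gtr0_norm p_gt0).
    by rewrite ler_wpM2l ?(ltW p_gt0).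
  have W1 := sum_geometric_le1 N p01.
  have W2 : \sum_(n < N) (1 - p) ^+ n * p ^+ 2 * n.+1%:R * 1 <= 4 * 1.
    apply: (sum_geometric_weight_natr_le (c := fun=> 1)) => // n.
    by rewrite sumr_const card_ord mul1r.
  apply: (@le_trans _ _ (M * (4 * eps + C * p))).
    rewrite ler_wpM2l// lerD//.
      by rewrite [leRHS]mulrC ler_wpM2l// -[leRHS]mulr1.
    by rewrite ler_piMr// mulr_ge0// ltW.
  rewrite ler_wpM2r//; first by rewrite addr_ge0 ?mulr_ge0// ltW.
  by rewrite /M' /A -mulrA mulrCA ler_peMr//; lra.
rewrite -[X in `|X|](subrKA (\sum_(n < N) (1 - p) ^+ n * p *
  (\int[P]_w f 0 (S p n.+1 w)))).
apply: (le_trans (ler_normD _ _)); apply: (le_trans (lerD drift tele)).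
rewrite -/A -/M' -mulrDr ler_wpM2l//.
have Kp : p <= p * K by rewrite ler_peMr// ltW.
have : C * p <= C * (p * K) by rewrite ler_wpM2l.
have : eps <= eps * K by rewrite ler_peMr.
have : 0 <= p * K by rewrite mulr_ge0// ltW.
by lra.
Qed.

(** The threshold [N0] may depend on [p]: it stands for summing the whole series at fixed [p]. *)
Lemma geometric_mean_limit (f : nat -> R -> R) (eta : R) : 0 < eta ->
  (forall k (x : R), is_derive x 1 (f k) (f k.+1 x)) -> smooth_bounded f ->
  \forall p \near (0 : R)^'+, exists N0, forall N, (N0 <= N)%N ->
    `|\sum_(n < N) (1 - p) ^+ n * p *
        (\int[P]_w f 0 (shifted_sum X (Num.sqrt p)
           (fun n => p * \sum_(j < n) a_ j) n.+1 w)) -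
      \int[mu]_y f 0 y| <= eta.
Proof.
move=> eta0 df sf.
have su : smooth_bounded (conv f) by exact: smooth_bounded_convolution.
have [Mf Mf0 fMf] := smooth_bounded_uniform 4 sf.
have [Mu Mu0 uMu] := smooth_bounded_uniform 4 su.
pose M := Mf + Mu.
have M0 : 0 <= M by exact: addr_ge0.
have fM k : (k <= 4)%N -> taylor_bounds M f k.
  by move=> k4; apply: taylor_bounds_le (fMf k k4); rewrite lerDl.
have uM k : (k <= 4)%N -> taylor_bounds M (conv f) k.
  by move=> k4; apply: taylor_bounds_le (uMu k k4); rewrite lerDr.
have [K' K'0 sK'] := cesaro_linear_bound (x := fun j => s j ^+ 2) s_mean.
pose K := 1 + K'.
have K1 : 1 <= K by rewrite lerDl.
have sK n : \sum_(j < n) (1 + s j ^+ 2) <= K * n%:R.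
  rewrite big_split /= sumr_const card_ord /K mulrDl mul1r lerD2l.
  exact: sK'.
pose M' := 2 * M * (1 + `|a| + a ^+ 2).
have M'0 : 0 <= M'.
  by rewrite !mulr_ge0// !addr_ge0// sqr_ge0.
(* [theta] serves as Cesaro error, truncation level and Lindeberg bound at once; together these cost
   [10 M' theta K], at most [eta / 2]. The terms in [p] and the boundary term get [eta / 4] each,
   and [M' + 1] avoids dividing by zero. *)
pose theta := eta / (20 * (M' + 1) * K).
have K0 : 0 < K by exact: lt_le_trans K1.
have M'1 : 0 < M' + 1 by exact: ltr_wpDl.
have theta0 : 0 < theta by rewrite divr_gt0// !mulr_gt0.
have [C1 C10 sB] := cesaro_bound (x := fun j => s j ^+ 2) theta0 s_mean.
have [C2 C20 aB] := cesaro_bound theta0 a_mean.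
pose C := C1 + C2.
have C0 : 0 <= C by exact: addr_ge0.
pose p1 := eta / (4 * (M' + 1) * (4 + 2 * C) * K).
have C4 : 0 < 4 + 2 * C by lra.
have p10 : 0 < p1 by rewrite divr_gt0// !mulr_gt0.
near=> p.
have p0 : 0 < p by near: p; exact: nbhs_right_gt.
have p_lt1 : p < 1 by near: p; exact: nbhs_right_lt.
have p01 : 0 < p < 1 by rewrite p0.
have pp1 : p <= p1 by near: p; exact: nbhs_right_le.
have tailL : forall N, \sum_(n < N) (1 - p) ^+ n * p * tail theta p n <= theta.
  by near: p; exact: lindeberg_near.
have zeta0 : 0 < eta / (4 * (M' + 1)) by rewrite divr_gt0// mulr_gt0.
have C'0 : 0 <= 1 + C by exact: addr_ge0.
have [N0 HN0] := geometric_linear_vanish p01 (ltW theta0) C'0 zeta0.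
exists N0 => N N0N.
have := HN0 N N0N.
have sBC n : `|\sum_(j < n) (s j ^+ 2 - sigma2)| <= theta * n%:R + C.
  by rewrite (le_trans (sB n))// lerD2l lerDl.
have aBC n : `|\sum_(j < n) (a_ j - a)| <= theta * n%:R + C.
  by rewrite (le_trans (aB n))// lerD2l lerDr.
have := geometric_mean_bound p01 df sf M0 fM uM K1 sK (ltW theta0) C0 theta0
  sBC aBC (tailL N).
rewrite -/M' => /le_trans H1 H2; apply: H1.
have -> : (1 - p) ^+ N * (1 + theta * N%:R + C) =
  (1 - p) ^+ N * (theta * N%:R + (1 + C)) by ring.
have T1 : theta * (20 * (M' + 1) * K) = eta by rewrite /theta divfK// gt_eqF// !mulr_gt0.
have T2 : p * (4 * (M' + 1) * (4 + 2 * C) * K) <= eta.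
  by rewrite -ler_pdivlMr// !mulr_gt0.
move: H2; rewrite ler_pdivlMr ?mulr_gt0//.
set Z := (1 - p) ^+ N * _ => H2.
have Z0 : 0 <= Z.
  have q0 : 0 <= 1 - p by lra.
  exact: mulr_ge0 (exprn_ge0 _ q0)
    (addr_ge0 (mulr_ge0 (ltW theta0) (ler0n _ _)) C'0).
have pK : 0 <= p * (4 + 2 * C) * K by rewrite !mulr_ge0// ltW.
have tK : 0 <= theta * K by rewrite mulr_ge0// ltW.
have tK1 : theta <= theta * K by rewrite ler_peMr// ltW.
have G1 : M' * Z <= Z * (4 * (M' + 1)) / 4 by lra.
have G2 : M' * ((4 + 2 * C) * p * K) <= eta / 4.
  by move: T2 pK; lra.
have G3 : M' * (theta * K + 8 * theta * K + theta) <= eta / 2.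
  have : M' * theta <= M' * (theta * K) by rewrite ler_wpM2l.
  by lra.
by lra.
Unshelve. all: by end_near. Qed.

End Limit.

(** * Comparing distribution functions with smooth steps *)

Section Sandwich.
Context {d : measure_display} {T : measurableType d} {R : realType}.
Variables (Q : probability T R) (Z : T -> R) (f : R -> R) (x eta : R).
Hypothesis mZ : measurable_fun setT Z.
Hypothesis mf : measurable_fun setT f.
Hypothesis f01 : forall y, 0 <= f y <= 1.

Let half : set T := Z @^-1` `]-oo, x]%classic.

Let mhalf : measurable half.
Proof. by rewrite -[half]setTI; apply: mZ. Qed.

Let half_int : Q.-integrable setT (EFin \o (\1_half : T -> R)).
Proof.
apply: (bounded_integrable Q (M := 1)); first exact: measurable_indic.
by move=> w; rewrite indicE; case: (_ \in _); rewrite ?normr1 ?normr0.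
Qed.

Let half_fine : fine (Q half) = \int[Q]_w \1_half w.
Proof. by rewrite /Rintegral integral_indic// setIT. Qed.

Let fZ_int : Q.-integrable setT (EFin \o (fun w => f (Z w))).
Proof.
apply: (bounded_integrable Q (M := 1)); first exact: measurableT_comp.
by move=> w; have /andP[f0 f1] := f01 (Z w); rewrite ger0_norm.
Qed.

Let eta_int : Q.-integrable setT (EFin \o (fun _ : T => eta)).
Proof. exact: (@bounded_integrable _ _ _ Q (cst eta) `|eta|). Qed.

(** This bound and the next serve both under [P], with [Z] a sum, and under [mu], with [Z] the
    identity. *)
Lemma probability_le_step : 0 <= eta -> (forall y, y <= x -> 1 - eta <= f y) ->
  fine (Q (Z @^-1` `]-oo, x]%classic)) <= \int[Q]_w f (Z w) + eta.
Proof.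
move=> eta0 fx; rewrite half_fine -[in leRHS](Rintegral_probability_cst Q eta) -RintegralD//.
apply: le_Rintegral => //; first exact: integrable_addr.
move=> w _; have /andP[f0 _] := f01 (Z w).
rewrite indicE; case: (boolP (w \in half)) => [|_]; last exact: addr_ge0.
by rewrite inE /half /= in_itv /= => /fx; rewrite lerBlDr.
Qed.

Lemma step_le_probability : 0 <= eta -> (forall y, x <= y -> f y <= eta) ->
  \int[Q]_w f (Z w) <= fine (Q (Z @^-1` `]-oo, x]%classic)) + eta.
Proof.
move=> eta0 fx; rewrite half_fine -[in leRHS](Rintegral_probability_cst Q eta) -RintegralD//.
apply: le_Rintegral => //; first exact: integrable_addr.
move=> w _; have /andP[_ f1] := f01 (Z w).
rewrite indicE; case: (boolP (w \in half)) => [_|].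
  by rewrite (le_trans f1)// lerDl.
rewrite notin_setE /half /= in_itv /= => /negP; rewrite -ltNge => /ltW /fx.
by rewrite add0r.
Qed.

End Sandwich.

(** * Conditioning on the geometric index *)

Section RandomIndex.
Context {d : measure_display} {T : measurableType d} {R : realType}.
Variables (P : probability T R) (N : {RV P >-> nat}).

Let measurable_index (B : set nat) : measurable (N @^-1` B).
Proof. by rewrite -[X in measurable X]setTI; apply: measurable_funP. Qed.

(** The leftover event collects both the indices above [m] and the index 0. *)
Lemma fine_probability_split (D : set T) (m : nat) : measurable D ->
  fine (P D) = \sum_(n < m) fine (P (N @^-1` [set n.+1] `&` D)) +
    fine (P (N @^-1` [set k | ~~ (0 < k <= m)%N] `&` D)).
Proof.
move=> mD; elim: m => [|m IHm].
  rewrite big_ord0 add0r (_ : [set k | _] = setT) ?preimage_setT ?setTI//.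
  by apply/seteqP; split => // -[|k].
rewrite IHm big_ord_recr /= -addrA; congr (_ + _).
rewrite (_ : N @^-1` [set k | ~~ (0 < k <= m)%N] `&` D =
  (N @^-1` [set m.+1] `&` D) `|` (N @^-1` [set k | ~~ (0 < k <= m.+1)%N] `&` D)).
  rewrite measureU ?fineD ?fin_num_measure//; try by apply: measurableI.
  apply/seteqP; split => // w [[/= -> _] [/=]].
  by rewrite leqnn.
apply/seteqP; split => w.
  move=> [/= Nw Dw]; have [Nm|Nm] := eqVneq (N w) m.+1; first by left.
  right; split => //=; apply: contra Nw => /andP[-> /=].
  by rewrite leq_eqVlt (negbTE Nm).
move=> [[/= -> Dw]|[/= Nw Dw]]; split => //=; first by rewrite ltnn.
by apply: contra Nw => /andP[-> /leqW].
Qed.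

Variables (X : nat -> {RV P >-> R}) (p : R).
Hypothesis N_geom : geometric_rv P p N.
Hypothesis N_indep : independent_of_family P N X.

(** Measurability of the sums is proved anew with [T] carrying only the sigma-algebra generated by
    the [X i], the one from which the index is independent. *)
Lemma generated_shifted_sum c b n (B : set R) : measurable B ->
  generated_sigma_algebra P X (shifted_sum X c b n @^-1` B).
Proof.
move=> mB.
pose G := \bigcup_i preimage_set_system setT (X i) measurable.
have mX j : measurable_fun setT (X j : g_sigma_algebraType G -> R).
  move=> _ A mA; apply: sub_sigma_algebra; exists j => //.
  by exists A.
have mS : measurable_fun setT (shifted_sum X c b n : g_sigma_algebraType G -> R).
  apply: measurable_funD => //; apply: measurable_funM => //.
  by apply: measurable_sum => j; exact: mX.
by have := mS measurableT B mB; rewrite setTI.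
Qed.

Lemma geometric_mixture c b (D : set T) (B : set R) (m : nat) :
  measurable D -> measurable B ->
  (forall n, N @^-1` [set n] `&` D = N @^-1` [set n] `&` shifted_sum X c b n @^-1` B) ->
  `|fine (P D) - \sum_(n < m) (1 - p) ^+ n * p *
     fine (P (shifted_sum X c b n.+1 @^-1` B))| <= (1 - p) ^+ m.
Proof.
move=> mD mB DB.
have mS n : measurable (shifted_sum X c b n @^-1` B).
  by rewrite -[X in measurable X]setTI; apply: measurable_funP.
rewrite (fine_probability_split m mD).
have -> : \sum_(n < m) fine (P (N @^-1` [set n.+1] `&` D)) =
    \sum_(n < m) (1 - p) ^+ n * p * fine (P (shifted_sum X c b n.+1 @^-1` B)).
  apply: eq_bigr => n _; rewrite DB N_indep//; last exact: generated_shifted_sum.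
  by rewrite N_geom fineM ?fin_num_measure.
rewrite addrC addKr ger0_norm ?fine_ge0//.
(* Splitting the whole space shows that the leftover event has probability exactly
   [(1 - p) ^+ m]. *)
have := fine_probability_split m measurableT.
have -> : \sum_(n < m) fine (P (N @^-1` [set n.+1] `&` setT)) = 1 - (1 - p) ^+ m.
  rewrite -sum_geometric; apply: eq_bigr => n _; rewrite setIT.
  by rewrite N_geom.
rewrite probability_setT setIT /= => E.
have -> : (1 - p) ^+ m = fine (P (N @^-1` [set k | ~~ (0 < k <= m)%N])) by lra.
by rewrite fine_le ?fin_num_measure ?le_measure ?inE//; apply: measurableI.
Qed.

End RandomIndex.

Lemma geometric_sumE {d : measure_display} {T : measurableType d} {R : realType}
    (P : probability T R) (X : nat -> {RV P >-> R}) (a : nat -> R) (p : R)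
    (N : {RV P >-> nat}) (w : T) : 0 <= p ->
  geometric_sum P X a p N w =
  shifted_sum X (Num.sqrt p) (fun n => p * \sum_(j < n) a j) (N w) w.
Proof.
move=> p0; rewrite /geometric_sum /shifted_sum /partial_sum big_split /= mulrDr.
by rewrite -mulr_sumr mulrA -expr2 sqr_sqrtr.
Qed.

(* The sequences X_j, a_j, sigma_j (j >= 1) are indexed from 0: the terms
   [X j], [a_ j], [s j] below are X_{j+1}, a_{j+1}, sigma_{j+1}. *)
Theorem theorem2p1 (R : realType) (d : measure_display) (T : measurableType d)
    (P : probability T R) (X : nat -> {RV P >-> R}) (s a_ : nat -> R)
    (nu : R -> {RV P >-> nat}) (alpha sigma2 a : R)
    (X_indep : mutually_independent P X)
    (X_mean : forall j, ('E_P[X j] = 0)%E)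
    (X_var : forall j, ('V_P[X j] = (s j ^+ 2)%:E)%E)
    (nu_geom : forall p : R, 0 < p < 1 -> geometric_rv P p (nu p))
    (nu_indep : forall p : R, 0 < p < 1 -> independent_of_family P (nu p) X)
    (alpha01 : 0 < alpha < 1)
    (s_small : n.+1%:R `^ (- alpha) * s n ^+ 2 @[n --> \oo] --> (0 : R))
    (s_mean : n%:R^-1 * (\sum_(j < n) s j ^+ 2) @[n --> \oo] --> sigma2)
    (sigma2_gt0 : 0 < sigma2)
    (a_mean : n%:R^-1 * (\sum_(j < n) a_ j) @[n --> \oo] --> a)
    (lindeberg : forall eps : R, 0 < eps ->
      (fun p : R => \sum_(0 <= j <oo) (((1 - p) ^+ j * p)%R%:E *
         'E_P[fun w => (X j w ^+ 2 *
                \1_[set w' | (eps / Num.sqrt p <= `|X j w'|)%R] w)%R]))%E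
        @ (0 : R)^'+ --> 0%E) :
  exists mu : probability (measurableTypeR R) R,
    is_asymmetric_laplace 0 a (Num.sqrt sigma2) mu /\
    cvg_in_distribution P (0 : R)^'+
      (fun p : R => geometric_sum P X a_ p (nu p)) mu.
Proof.
have [mu mu_res] := @resolvent_law_exists R a sigma2 sigma2_gt0.
exists mu; split; first exact: resolvent_law_asymmetric_laplace.
move=> x x_cont.
pose G y := fine (mu `]-oo, y]%classic).
have mu_fin y : mu `]-oo, y]%classic \is a fin_num by exact: fin_num_measure.
have G_cont : G y @[y --> x] --> G x.
  by apply: fine_cvg; rewrite fineK//; exact: x_cont.
rewrite -(fineK (mu_fin x)); apply: cvg_EFin.
  by near=> p; exact: fin_num_measure.
apply/cvgrPdist_le => eta eta0.
(* Each side of the squeeze costs five times [zeta]: truncation of the index, the limit for the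
   smooth step, the comparison under [P], the comparison under [mu], and continuity at [x]. *)
pose zeta := eta / 8.
have zeta0 : 0 < zeta by rewrite divr_gt0.
have [r r0 Gr] : exists2 r : R, 0 < r &
    forall y, `|x - y| < r -> `|G x - G y| <= zeta.
  have /cvgrPdist_le/(_ _ zeta0)/nbhs_ballP[r r0 Gr] := G_cont.
  by exists r => // y xy; exact: Gr.
pose h := r / 4.
have h0 : 0 < h by rewrite divr_gt0.
(* Off-centre steps: [f] falls between [x] and [x + 2 h], [g] between [x - 2 h] and [x], so they
   squeeze the indicator up to [zeta]. As [2 h < r], the distribution function of [mu] moves by at
   most [zeta] there. *)
have [f [df f01 sf f_low f_high]] := smooth_step_exists (x + h) h0 zeta0.
have [g [dg g01 sg g_low g_high]] := smooth_step_exists (x - h) h0 zeta0.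
have zeta_ge0 := ltW zeta0.
have mf : measurable_fun setT (f 0) by exact: smooth_bounded_measurable.
have mg : measurable_fun setT (g 0) by exact: smooth_bounded_measurable.
have mid : measurable_fun setT (id : measurableTypeR R -> R) by [].
have G_high : \int[mu]_y f 0 y <= G x + 2 * zeta.
  have := @step_le_probability _ _ _ mu id (f 0) (x + h + h) zeta mid mf f01 zeta_ge0 f_high.
  have : `|G x - G (x + h + h)| <= zeta.
    by apply: Gr; rewrite ler0_norm /h; lra.
  by rewrite ler_norml /G /= => /andP[]; lra.
have G_low : G x - 2 * zeta <= \int[mu]_y g 0 y.
  have := @probability_le_step _ _ _ mu id (g 0) (x - h - h) zeta mid mg g01 zeta_ge0 g_low.
  have : `|G x - G (x - h - h)| <= zeta.
    by apply: Gr; rewrite ger0_norm /h; lra.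
  by rewrite ler_norml /G /= => /andP[]; lra.
have f_lim := geometric_mean_limit X_indep X_mean X_var s_mean a_mean lindeberg
  mu_res zeta0 df sf.
have g_lim := geometric_mean_limit X_indep X_mean X_var s_mean a_mean lindeberg
  mu_res zeta0 dg sg.
have p_01 : \forall p \near (0 : R)^'+, 0 < p < 1.
  by near=> p; apply/andP; split; near: p; [exact: nbhs_right_gt|exact: nbhs_right_lt].
move: p_01 f_lim g_lim; apply: filterS3 => p p01 [Nf f_mean] [Ng g_mean].
have /andP[p0 p1] := p01.
have [Nq q_small] := geometric_linear_vanish p01 (lexx 0) ler01 zeta0.
pose m := maxn Nf (maxn Ng Nq).
have := f_mean m (leq_maxl _ _).
have {g_mean} := g_mean m (leq_trans (leq_maxl _ _) (leq_maxr _ _)).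
have {q_small} := q_small m (leq_trans (leq_maxr _ _) (leq_maxr _ _)).
rewrite mul0r add0r mulr1.
pose Y n := shifted_sum X (Num.sqrt p) (fun n => p * \sum_(j < n) a_ j) n.
have mY n : measurable_fun setT (Y n) by exact: measurable_shifted_sum.
set Sg := \sum_(n < m) _; set q := (1 - p) ^+ m => q_le.
set Sf := \sum_(n < m) _ => g_le f_le.
pose H n := fine (P (Y n @^-1` `]-oo, x]%classic)).
have q0 n : 0 <= (1 - p) ^+ n * p.
  by rewrite mulr_ge0 ?exprn_ge0 ?subr_ge0 ?(ltW p1)// ltW.
have shift_le (u v : nat -> R) : (forall n, u n <= v n + zeta) ->
    \sum_(n < m) (1 - p) ^+ n * p * u n <= \sum_(n < m) (1 - p) ^+ n * p * v n + zeta.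
  move=> uv.
  apply: (@le_trans _ _ (\sum_(n < m) (1 - p) ^+ n * p * (v n + zeta))).
    by apply: ler_sum => n _; rewrite ler_wpM2l.
  rewrite (eq_bigr (fun n : 'I_m => (1 - p) ^+ n * p * v n + (1 - p) ^+ n * p * zeta)).
    by rewrite big_split /= lerD2l -mulr_suml ler_piMl// sum_geometric_le1.
  by move=> n _; rewrite mulrDr.
have fx_low y : y <= x -> 1 - zeta <= f 0 y.
  by move=> yx; apply: f_low; rewrite addrK.
have gx_high y : x <= y -> g 0 y <= zeta.
  by move=> yx; apply: g_high; rewrite subrK.
have H_le := shift_le (fun n => H n.+1) (fun n => \int[P]_w f 0 (Y n.+1 w))
  (fun n => probability_le_step P (mY n.+1) mf f01 zeta_ge0 fx_low).
have H_ge := shift_le (fun n => \int[P]_w g 0 (Y n.+1 w)) (fun n => H n.+1)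
  (fun n => step_le_probability P (mY n.+1) mg g01 zeta_ge0 gx_high).
have mD : measurable (geometric_sum P X a_ p (nu p) @^-1` `]-oo, x]%classic).
  by rewrite -[X in measurable X]setTI; apply: measurable_funP.
(* Where the index equals [n], the geometric sum is a sum of fixed length, which is independent of
   the index. *)
have DB n : nu p @^-1` [set n] `&` geometric_sum P X a_ p (nu p) @^-1` `]-oo, x]%classic =
    nu p @^-1` [set n] `&` Y n @^-1` `]-oo, x]%classic.
  by apply/seteqP; split => w [/= nun]; rewrite geometric_sumE ?(ltW p0)// nun.
have mix := geometric_mixture (nu_geom p p01) (nu_indep p p01) m mD
  (measurable_itv _) DB.
rewrite /= /cdf /distribution /pushforward.
move: mix f_le g_le H_le H_ge; rewrite -/Sf -/Sg -/q.
set Fp := fine _; set SH := \sum_(n < m) _.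
rewrite !ler_norml => /andP[? ?] /andP[? ?] /andP[? ?] ? ?.
rewrite -/(G x) in G_high G_low *.
have zetaE : eta = 8 * zeta by rewrite /zeta; lra.
by apply/andP; split; lra.
Unshelve. all: by end_near. Qed.
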